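(* Let $\widetilde\Lambda\subset\widehat{\mathrm{Ein}}_2$ be a generic, nonelementary, closed achronal subset, with projection $\Lambda\subset\mathrm{Ein}_2$. Then the invisible domain $E(\Lambda)$ is the union of the past globally hyperbolic core $E(\Lambda^-)$, the future globally hyperbolic core $E(\Lambda^+)$, and the closed ends $\overline{\mathcal E}_{xy}$ associated to the gap pairs $(x,y)$ of $\widetilde\Lambda$.
   Context: Let $E=\mathbb R^4$ with $Q=-u^2-v^2+x_1^2+x_2^2$, $S(E)$ the space of rays of $E$, $\mathbb{ADS}=\{[x]\in S(E):Q(x)<0\}$ (the Klein model of $\mathrm{AdS}=\{Q=-1\}$), $\mathrm{Ein}_2=\{[x]\in S(E):Q(x)=0\}$. Let $\mathbb D^2=\{p\in S^2:p_3>0\}$ and $d$ the spherical distance. The map $\overline{\mathbb D}^2\times\mathbb R\to S(E)$, $(p,\theta)\mapsto[(\cos\theta,\sin\theta,p_1,p_2)]$ identifies $\mathbb D^2\times\mathbb R$ with the universal covering $\widetilde{\mathrm{AdS}}$ and $\partial\mathbb D^2\times\mathbb R$ with the infinite cyclic covering $\widehat{\mathrm{Ein}}_2$ of $\mathrm{Ein}_2$; time orientation: $\theta$ increasing. A subset $\widetilde\Lambda\subset\widehat{\mathrm{Ein}}_2$ is achronal if $d(x,y)\ge|\theta-\theta'|$ for all $(x,\theta),(y,\theta')\in\widetilde\Lambda$; it is then the graph of a $1$-Lipschitz $f:\Lambda_0\to\mathbb R$, $\Lambda_0\subset\partial\mathbb D^2$. Opposite points are pairs $(x,\theta),(-x,\theta+\pi)$.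 The past (future) lightcone of a point is the union of the past (future) oriented lightlike geodesic rays $s\mapsto(x(s),\theta_0\mp s)$, $s\ge0$, from it, with $x(s)$ unit-speed on $\partial\mathbb D^2$. An achronal $\widetilde\Lambda$ is pure lightlike if it contains two opposite points and lies in the past lightcone of one and the future lightcone of the other; otherwise generic. It is nonelementary if no past lightcone and no future lightcone of a point of $\widehat{\mathrm{Ein}}_2$ contains it. For $x\in\overline{\mathbb D}^2$ put $f_-(x)=\sup_{y\in\Lambda_0}(f(y)-d(x,y))$, $f_+(x)=\inf_{y\in\Lambda_0}(f(y)+d(x,y))$. $E(\Lambda)\subset\mathbb{ADS}$ is the projection of $E(\widetilde\Lambda)=\{(x,\theta)\in\mathbb D^2\times\mathbb R:f_-(x)<\theta<f_+(x)\}$. Let $\widetilde\Lambda^\pm$ be the graph of $f_\pm|_{\partial\mathbb D^2}$ (an achronal topological circle containing $\widetilde\Lambda$), and $\Lambda^\pm$ its projection; $E(\Lambda^\pm)$ is the projection of $E(\widetilde\Lambda^\pm)$, defined in the same way from $\widetilde\Lambda^\pm$. A gap pair is a pair $(x,y)$ of points of $\widetilde\Lambda$ lying over the two endpoints of a connected component $I$ of $\partial\mathbb D^2\setminus\Lambda_0$. Let $\Delta_{xy}\subset\mathrm{Ein}_2$ be the projection of $\{(p,\theta):p\in I,\ f_-(p)<\theta<f_+(p)\}$ (a diamond-shaped region, empty if $x,y$ are the endpoints of a lightlike segment over $I$). The closed end $\overline{\mathcal E}_{xy}$ is the intersection of $\mathbb{ADS}$ with the closed convex hull in $S(E)$ of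 $\Delta_{xy}$ (empty if $\Delta_{xy}$ is empty); when $\Delta_{xy}\neq\emptyset$, this hull is the closed tetrahedron consisting of the rays of nonzero vectors $ax+by+cz^++dz^-$, $a,b,c,d\ge0$, where $x,y$ also denote vectors on the corresponding rays and $z^+$, $z^-$ are vectors on the rays of the upper and lower corners of the diamond (the first intersection points, over $\bar I$, of the two future-oriented, resp. past-oriented, lightlike segments issued from $x$ and $y$). Convex hulls in $S(E)$ are projections of convex hulls of cones in $E$. *)

(* Defs.v *)
From HB Require Import structures.
From mathcomp Require Import all_boot all_order all_algebra.
From mathcomp Require Import all_classical all_reals all_analysis.

Set Implicit Arguments.
Unset Strict Implicit.
Unset Printing Implicit Defensive.

Import Order.TTheory GRing.Theory Num.Theory.
Import numFieldNormedType.Exports.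

Local Open Scope classical_set_scope.
Local Open Scope ring_scope.

(** ** The Klein model: rays of [R^4] with coordinates [(u, v, x_1, x_2)] *)

Definition qform (R : realType) (v : 'rV[R]_4) : R :=
  - v 0 0 ^+ 2 - v 0 1 ^+ 2 + v 0 2 ^+ 2 + v 0 3 ^+ 2.

(* Subsets of the space of rays S(E) are represented as sets of rays, a ray
   being itself the set of positive multiples of a nonzero vector. *)
Definition ray (R : realType) (v : 'rV[R]_4) : set 'rV[R]_4 :=
  [set t *: v | t in [set t : R | 0 < t]].

Definition ray_space (R : realType) : set (set 'rV[R]_4) :=
  [set ray v | v in [set v : 'rV[R]_4 | v != 0]].

Definition ADS (R : realType) : set (set 'rV[R]_4) :=
  [set ray v | v in [set v : 'rV[R]_4 | qform v < 0]].

Definition cone_over (R : realType) (A : set (set 'rV[R]_4)) : set 'rV[R]_4 :=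
  [set v | v != 0 /\ A (ray v)].

(* The convex hull in S(E) is the projection of the convex hull in E of the
   cone over the given set. *)
Definition ray_hull (R : realType) (A : set (set 'rV[R]_4)) :
    set (set 'rV[R]_4) :=
  [set ray v | v in
    [set v | v != 0 /\ smallest (@convex_set R 'rV[R]_4) (cone_over A) v]].

(* S(E) carries the quotient topology of E \ {0}; since E \ {0} is open in E,
   openness of the preimage may be tested in E. *)
Definition ray_open (R : realType) (U : set (set 'rV[R]_4)) : Prop :=
  U `<=` @ray_space R /\ open (cone_over U).

Definition ray_closure (R : realType) (A : set (set 'rV[R]_4)) :
    set (set 'rV[R]_4) :=
  [set r | ray_space r /\
    forall U, ray_open U -> U r -> U `&` A !=set0].

(** ** The sphere [S^2], the hemisphere and the universal cover *)

Definition dotp (R : realType) (p q : 'rV[R]_3) : R :=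
  \sum_(i < 3) p 0 i * q 0 i.

Definition sphere (R : realType) : set 'rV[R]_3 := [set p | dotp p p = 1].

Definition disk (R : realType) : set 'rV[R]_3 :=
  [set p | sphere p /\ 0 < p 0 2].

(* The boundary of the hemisphere [disk]. *)
Definition circle (R : realType) : set 'rV[R]_3 :=
  [set p | sphere p /\ p 0 2 = 0].

Definition sdist (R : realType) (p q : 'rV[R]_3) : R := acos (dotp p q).

Definition Einhat (R : realType) : set ('rV[R]_3 * R) :=
  [set q | circle q.1].

(* The projection (p, theta) |-> [(cos theta, sin theta, p_1, p_2)]; it takes
   disk x R to ADS and Einhat to the null rays. *)
Definition ray_proj (R : realType) (q : 'rV[R]_3 * R) : set 'rV[R]_4 :=
  ray (\row_(j < 4) [:: cos q.2; sin q.2; q.1 0 0; q.1 0 1]`_j).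

(** ** Causality in [Einhat] *)

Definition achronal (R : realType) (L : set ('rV[R]_3 * R)) : Prop :=
  forall q r, L q -> L r -> `|q.2 - r.2| <= sdist q.1 r.1.

(* Rotation by the angle s about the third axis: the unit-speed
   parametrizations of the circle starting at x are s |-> turn (+/- s) x. *)
Definition turn (R : realType) (s : R) (x : 'rV[R]_3) : 'rV[R]_3 :=
  \row_(j < 3) [:: cos s * x 0 0 - sin s * x 0 1;
                   sin s * x 0 0 + cos s * x 0 1;
                   x 0 2]`_j.

Definition past_lightcone (R : realType) (q : 'rV[R]_3 * R) :
    set ('rV[R]_3 * R) :=
  [set r | exists (b : bool) (s : R),
    0 <= s /\ r = (turn ((-1) ^+ b * s) q.1, q.2 - s)].

Definition future_lightcone (R : realType) (q : 'rV[R]_3 * R) :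
    set ('rV[R]_3 * R) :=
  [set r | exists (b : bool) (s : R),
    0 <= s /\ r = (turn ((-1) ^+ b * s) q.1, q.2 + s)].

Definition opposite (R : realType) (q r : 'rV[R]_3 * R) : Prop :=
  r = (- q.1, q.2 + pi) \/ q = (- r.1, r.2 + pi).

Definition pure_lightlike (R : realType) (L : set ('rV[R]_3 * R)) : Prop :=
  exists q r, [/\ L q, L r, opposite q r,
    L `<=` past_lightcone q & L `<=` future_lightcone r].

Definition generic (R : realType) (L : set ('rV[R]_3 * R)) : Prop :=
  ~ pure_lightlike L.

Definition nonelementary (R : realType) (L : set ('rV[R]_3 * R)) : Prop :=
  forall q, Einhat q ->
    ~ (L `<=` past_lightcone q) /\ ~ (L `<=` future_lightcone q).

(** ** Invisible domains *)

Definition base_set (R : realType) (L : set ('rV[R]_3 * R)) : set 'rV[R]_3 :=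
  [set q.1 | q in L].

(* An achronal L is the graph of a function f on its base, so that ranging
   over the points (y, f y) of the graph is ranging over y in the base. *)
Definition fminus (R : realType) (L : set ('rV[R]_3 * R)) (x : 'rV[R]_3) : R :=
  sup [set q.2 - sdist x q.1 | q in L].

Definition fplus (R : realType) (L : set ('rV[R]_3 * R)) (x : 'rV[R]_3) : R :=
  inf [set q.2 + sdist x q.1 | q in L].

Definition invisible_domain (R : realType) (L : set ('rV[R]_3 * R)) :
    set (set 'rV[R]_4) :=
  [set ray_proj q | q in [set q : 'rV[R]_3 * R |
    disk q.1 /\ fminus L q.1 < q.2 < fplus L q.1]].

Definition graph_minus (R : realType) (L : set ('rV[R]_3 * R)) :
    set ('rV[R]_3 * R) :=
  [set q | circle q.1 /\ q.2 = fminus L q.1].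

Definition graph_plus (R : realType) (L : set ('rV[R]_3 * R)) :
    set ('rV[R]_3 * R) :=
  [set q | circle q.1 /\ q.2 = fplus L q.1].

(** ** Gaps and closed ends *)

Definition gap (R : realType) (L : set ('rV[R]_3 * R)) (I : set 'rV[R]_3) :
    Prop :=
  exists2 p, (@circle R `\` base_set L) p &
    I = connected_component (@circle R `\` base_set L) p.

(* The component I is an open arc of the circle; its endpoints are the points
   of its closure that do not belong to it. *)
Definition gap_pair (R : realType) (L : set ('rV[R]_3 * R))
    (I : set 'rV[R]_3) (x y : 'rV[R]_3 * R) : Prop :=
  [/\ gap L I, L x, L y & closure I `\` I = [set x.1; y.1]].

Definition diamond (R : realType) (L : set ('rV[R]_3 * R))
    (I : set 'rV[R]_3) : set (set 'rV[R]_4) :=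
  [set ray_proj q | q in [set q : 'rV[R]_3 * R |
    I q.1 /\ fminus L q.1 < q.2 < fplus L q.1]].

(* Indexed by the gap rather than by its pair of endpoints, the latter
   determining the former as soon as the base has at least three points. *)
Definition closed_end (R : realType) (L : set ('rV[R]_3 * R))
    (I : set 'rV[R]_3) : set (set 'rV[R]_4) :=
  @ADS R `&` ray_closure (ray_hull (diamond L I)).

(* Main.v *)
(* Write points of the Einstein universe in null coordinates A = (theta + phi)/2,
   B = (theta - phi)/2: the pairing of E between such points is
   2 sin (A - A') sin (B - B'), and a diamond is a product of two intervals of
   length less than pi (by nonelementarity), so its four corners form a basis of
   E in which the closed hull is the orthant of nonnegative coordinates.

   The invisible domain consists of the rays of vectors v with Q(v) < 0 and
   <v, w> < 0 for all w in Lambda.  On a closed end, Q(v) < 0 makes the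
   coordinates of v along the endpoints x and y positive, so <v, w> can vanish
   only at the corner of the rectangle opposite to the gap, and if this corner
   belonged to Lambda then Lambda would lie in its lightcone.

   Conversely, a point of E(Lambda) outside both cores lies in the future of a
   point q of Lambda^- and in the past of a point q' of Lambda^+.  If q and q'
   lay over distinct gaps, Lambda would separate them on both sides and the height
   gain from q to q' would be at most d(q, q'), contradicting the triangle
   inequality.  Hence both lie over one gap, the point pairs nonnegatively with
   the two corners z+, z- and negatively with x, y, and it is in the hull. *)
Require Import Defs.
From HB Require Import structures.
From mathcomp Require Import all_boot all_order all_algebra.
From mathcomp Require Import all_classical all_reals all_analysis.
From mathcomp Require Import ring lra.

Set Implicit Arguments.
Unset Strict Implicit.
Unset Printing Implicit Defensive.

Import Order.TTheory GRing.Theory Num.Theory.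
Import numFieldNormedType.Exports.

Local Open Scope classical_set_scope.
Local Open Scope ring_scope.

(** * Spherical distance, and angular coordinates on the boundary circle *)

Section SphereGeometry.
Variable R : realType.
Implicit Types (s t u phi psi : R) (p q x y z : 'rV[R]_3).

Definition cpt phi : 'rV[R]_3 := \row_(j < 3) [:: cos phi; sin phi; 0]`_j.

Lemma row3P p q : p 0 0 = q 0 0 -> p 0 1 = q 0 1 -> p 0 2 = q 0 2 -> p = q.
Proof.
move=> h0 h1 h2; apply/rowP => -[[|[|[|//]]] i].
- by rewrite (_ : Ordinal i = 0)//; exact: val_inj.
- by rewrite (_ : Ordinal i = 1)//; exact: val_inj.
- by rewrite (_ : Ordinal i = 2)//; exact: val_inj.
Qed.

Lemma dotpE p q : dotp p q = p 0 0 * q 0 0 + p 0 1 * q 0 1 + p 0 2 * q 0 2.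
Proof.
rewrite /dotp !big_ord_recl big_ord0 addr0 addrA.
by congr (_ + _ * _ + _ * _); congr (_ _ _); exact: val_inj.
Qed.

Lemma cptE phi :
  (cpt phi 0 0 = cos phi) * (cpt phi 0 1 = sin phi) * (cpt phi 0 2 = 0).
Proof. by rewrite !mxE. Qed.

Lemma sphereE p :
  sphere p = (p 0 0 ^+ 2 + p 0 1 ^+ 2 + p 0 2 ^+ 2 = 1) :> Prop.
Proof. by rewrite /sphere /= dotpE -!expr2. Qed.

Lemma circle_cpt phi : circle (cpt phi).
Proof. by rewrite /circle /= sphereE !cptE expr0n addr0 cos2Dsin2. Qed.

Lemma circle_sphere p : circle p -> sphere p.
Proof. by case. Qed.

Lemma disk_sphere p : disk p -> sphere p.
Proof. by case. Qed.

Lemma cos_sub2pi t : cos (pi *+ 2 - t) = cos t :> R.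
Proof. by rewrite addrC cosD2pi cosN. Qed.

Lemma sin_sub2pi t : sin (pi *+ 2 - t) = - sin t :> R.
Proof. by rewrite addrC sinD2pi sinN. Qed.

Lemma angle_exists m s t : s ^+ 2 + t ^+ 2 = 1 ->
  exists phi : R, [/\ m <= phi < m + pi *+ 2, cos phi = s & sin phi = t].
Proof.
move=> st.
suff base s' t' : s' ^+ 2 + t' ^+ 2 = 1 ->
    exists phi : R, [/\ 0 <= phi < pi *+ 2, cos phi = s' & sin phi = t'].
  have cs := cos2Dsin2 m.
  have [|phi [phi02 hc hs]] :=
      base (s * cos m + t * sin m) (t * cos m - s * sin m).
    rewrite -[RHS](mulr1 1) -{1}st -cs; ring.
  exists (m + phi); split; first lra.
  - rewrite cosD hc hs.
    transitivity (s * (cos m ^+ 2 + sin m ^+ 2)); first ring.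
    by rewrite cs mulr1.
  - rewrite sinD hc hs.
    transitivity (t * (cos m ^+ 2 + sin m ^+ 2)); first ring.
    by rewrite cs mulr1.
move=> {}st.
have s1 : -1 <= s' <= 1 by nra.
have acosK' : cos (acos s') = s' by rewrite acosK // in_itv.
have a0 := acos_ge0 s1; have api := acos_lepi s1; have pi0 := pi_gt0 R.
have sacos : sin (acos s') = `|t'|.
  by rewrite sin_acos// -sqrtr_sqr; congr Num.sqrt; rewrite -st; ring.
have [t0|t0] := leP 0 t'.
- by exists (acos s'); rewrite acosK' sacos ger0_norm//; split => //; lra.
- exists (pi *+ 2 - acos s').
  rewrite cos_sub2pi sin_sub2pi acosK' sacos ltr0_norm// opprK; split => //.
  have : acos s' != 0.
    by apply/eqP => a00; move: sacos; rewrite a00 sin0 ltr0_norm//; lra.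
  by lra.
Qed.

Lemma circle_param m p : circle p ->
  exists2 phi : R, m <= phi < m + pi *+ 2 & p = cpt phi.
Proof.
case; rewrite sphereE => + p2; rewrite p2 expr0n addr0 => p1.
have [phi [phim hc hs]] := angle_exists m p1.
by exists phi => //; apply: row3P; rewrite !cptE.
Qed.

Lemma dotp_cpt phi psi : dotp (cpt phi) (cpt psi) = cos (phi - psi).
Proof. by rewrite dotpE !cptE cosB; ring. Qed.

Lemma cptD2pi phi : cpt (phi + pi *+ 2) = cpt phi.
Proof. by apply: row3P; rewrite !cptE ?cosD2pi ?sinD2pi. Qed.

Lemma turn_cpt s phi : turn s (cpt phi) = cpt (phi + s).
Proof.
by apply: row3P; rewrite !mxE /= ?cosD ?sinD; ring.
Qed.

Lemma dotpC p q : dotp p q = dotp q p.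
Proof. by rewrite !dotpE; ring. Qed.

Lemma sdistC p q : sdist p q = sdist q p.
Proof. by rewrite /sdist dotpC. Qed.

(** Both sides are the Gram determinant of [x], [y], [z]: on the left arranged as in the law of
    cosines at [y], on the right as a squared determinant expanded along the third coordinate. *)
Lemma gram_det x y z : sphere x -> sphere y -> sphere z ->
  (1 - dotp x y ^+ 2) * (1 - dotp y z ^+ 2)
    - (dotp x z - dotp x y * dotp y z) ^+ 2 =
  (x 0 2 * (y 0 0 * z 0 1 - y 0 1 * z 0 0)
   - y 0 2 * (x 0 0 * z 0 1 - x 0 1 * z 0 0)
   + z 0 2 * (x 0 0 * y 0 1 - x 0 1 * y 0 0)) ^+ 2.
Proof.
rewrite !sphereE => sx sy sz.
set X := _ + _ in sx; set Y := _ + _ in sy; set Z := _ + _ in sz.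
(* Reinserting the squared norms [X], [Y], [Z], all equal to 1, makes the equality a polynomial
   identity. *)
transitivity ((X * Y - dotp x y ^+ 2) * (Y * Z - dotp y z ^+ 2)
    - (dotp x z * Y - dotp x y * dotp y z) ^+ 2).
  by rewrite sx sy sz; ring.
transitivity (Y * (x 0 2 * (y 0 0 * z 0 1 - y 0 1 * z 0 0)
   - y 0 2 * (x 0 0 * z 0 1 - x 0 1 * z 0 0)
   + z 0 2 * (x 0 0 * y 0 1 - x 0 1 * y 0 0)) ^+ 2).
  by rewrite !dotpE /X /Y /Z; ring.
by rewrite sy mul1r.
Qed.

Lemma dotp_itv p q : sphere p -> sphere q -> -1 <= dotp p q <= 1.
Proof.
rewrite !sphereE => sp sq.
have sumsq (a b c : R) : 0 <= a ^+ 2 + b ^+ 2 + c ^+ 2.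
  by rewrite !addr_ge0 ?sqr_ge0.
have := sumsq (p 0 0 - q 0 0) (p 0 1 - q 0 1) (p 0 2 - q 0 2).
have := sumsq (p 0 0 + q 0 0) (p 0 1 + q 0 1) (p 0 2 + q 0 2).
by rewrite dotpE; lra.
Qed.

Lemma cos_sdist p q : sphere p -> sphere q -> cos (sdist p q) = dotp p q.
Proof. by move=> sp sq; rewrite acosK// in_itv /= dotp_itv. Qed.

Lemma sdist_ge0 p q : sphere p -> sphere q -> 0 <= sdist p q.
Proof. by move=> sp sq; rewrite acos_ge0 ?dotp_itv. Qed.

Lemma sdist_lepi p q : sphere p -> sphere q -> sdist p q <= pi.
Proof. by move=> sp sq; rewrite acos_lepi ?dotp_itv. Qed.

Lemma ler_cos_pi s t : 0 <= s <= pi -> 0 <= t <= pi ->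
  (cos s <= cos t) = (t <= s).
Proof. by move=> s0 t0; rewrite !leNgt ltr_cos ?in_itv. Qed.

(** When the sum is below [pi], cosines can be compared: since the Gram determinant is nonnegative,
    [dotp x z] is at least the cosine of the sum. *)
Lemma sdist_triangle x y z : sphere x -> sphere y -> sphere z ->
  sdist x z <= sdist x y + sdist y z.
Proof.
move=> sx sy sz.
have [xy0 xypi] := (sdist_ge0 sx sy, sdist_lepi sx sy).
have [yz0 yzpi] := (sdist_ge0 sy sz, sdist_lepi sy sz).
have [xz0 xzpi] := (sdist_ge0 sx sz, sdist_lepi sx sz).
have [big|small] := leP pi (sdist x y + sdist y z); first exact: le_trans big.
rewrite -ler_cos_pi ?xz0 ?addr_ge0 ?(ltW small)// cosD !cos_sdist//.
have sxy : 0 <= sin (sdist x y) by rewrite sin_ge0_pi// xy0.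
have syz : 0 <= sin (sdist y z) by rewrite sin_ge0_pi// yz0.
have := sqr_ge0 (x 0 2 * (y 0 0 * z 0 1 - y 0 1 * z 0 0)
   - y 0 2 * (x 0 0 * z 0 1 - x 0 1 * z 0 0)
   + z 0 2 * (x 0 0 * y 0 1 - x 0 1 * y 0 0)).
rewrite -gram_det// -{1}(cos_sdist sx sy) -{1}(cos_sdist sy sz) -!sin2cos2.
move: sxy syz; set a := sin _; set b := sin _ => a0 b0 e.
have [//|lt] := leP (dotp x y * dotp y z - a * b) (dotp x z).
by have := mulr_ge0 a0 b0; nra.
Qed.

Lemma sphereN p : sphere p -> sphere (- p).
Proof. by rewrite !sphereE !mxE !sqrrN. Qed.

Lemma sdistN p q : sphere p -> sphere q -> sdist p (- q) = pi - sdist p q.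
Proof.
move=> sp sq; rewrite /sdist -acosN ?dotp_itv//; congr acos.
by rewrite !dotpE !mxE; ring.
Qed.

(** This is the triangle inequality from [y] to [z] through the antipode of [x]. *)
Lemma sdist_perimeter x y z : sphere x -> sphere y -> sphere z ->
  sdist x y + sdist y z + sdist x z <= pi *+ 2.
Proof.
move=> sx sy sz; have := sdist_triangle sy (sphereN sx) sz.
rewrite sdistN// [sdist (- x) z]sdistC sdistN// [sdist y x]sdistC.
by rewrite [sdist z x]sdistC; lra.
Qed.

Lemma sdistxx p : sphere p -> sdist p p = 0.
Proof. by rewrite /sphere /sdist => ->; rewrite acos1. Qed.

Lemma sdist_cpt phi psi : `|phi - psi| <= pi ->
  sdist (cpt phi) (cpt psi) = `|phi - psi|.
Proof.
by move=> le; rewrite /sdist dotp_cpt -cos_norm cosK// in_itv /= le normr_ge0.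
Qed.

Lemma sdist_cpt_le phi psi : sdist (cpt phi) (cpt psi) <= `|phi - psi|.
Proof.
have [le|/ltW le] := leP `|phi - psi| pi; first by rewrite sdist_cpt.
by apply: le_trans le; apply: sdist_lepi; apply: circle_sphere; exact: circle_cpt.
Qed.

Lemma sdist_cpt_le2pi phi psi : phi <= psi -> psi <= phi + pi *+ 2 ->
  sdist (cpt phi) (cpt psi) <= pi *+ 2 - (psi - phi).
Proof.
move=> le1 le2; rewrite -(cptD2pi phi); apply: le_trans (sdist_cpt_le _ _) _.
by rewrite ger0_norm; lra.
Qed.

Lemma sdist_cpt_min phi psi : phi <= psi -> psi <= phi + pi *+ 2 ->
  sdist (cpt phi) (cpt psi) = Num.min (psi - phi) (pi *+ 2 - (psi - phi)).
Proof.
move=> le1 le2; case: (leP (psi - phi) (pi *+ 2 - (psi - phi))) => h.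
  by rewrite sdist_cpt ?ler0_norm; lra.
rewrite -(cptD2pi phi) sdist_cpt ?ger0_norm; lra.
Qed.

(* Equality in the triangle inequality forces the three points to lie on a
   great circle, which meets the equator only in antipodal points. *)
Lemma sdist_through_disk p x y : disk p -> circle x -> circle y ->
  sdist p x + sdist p y <= sdist x y -> sdist x y = pi.
Proof.
move=> [sp p2] [sx x2] [sy y2] le.
have [px0 pxpi] := (sdist_ge0 sp sx, sdist_lepi sp sx).
have [py0 pypi] := (sdist_ge0 sp sy, sdist_lepi sp sy).
have [xy0 xypi] := (sdist_ge0 sx sy, sdist_lepi sx sy).
have : cos (sdist x y) <= cos (sdist p x + sdist p y).
  by rewrite ler_cos_pi ?xy0 ?addr_ge0 ?(le_trans le).
rewrite cosD !cos_sdist// => h.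
have ab0 : 0 <= sin (sdist p x) * sin (sdist p y).
  by rewrite mulr_ge0 ?sin_ge0_pi ?px0 ?py0.
have := gram_det sx sp sy; rewrite x2 y2 !mul0r sub0r addr0 (dotpC x p).
have e1 : 1 - dotp p x ^+ 2 = sin (sdist p x) ^+ 2.
  by rewrite sin2cos2 cos_sdist.
have e2 : 1 - dotp p y ^+ 2 = sin (sdist p y) ^+ 2.
  by rewrite sin2cos2 cos_sdist.
rewrite e1 e2 sqrrN exprMn => e.
(* By [h] the left side of [e] is nonpositive, while the right side is a product of squares. As
   [0 < p 0 2], the cross product of [x] and [y] vanishes. *)
have /eqP : p 0 2 ^+ 2 * (x 0 0 * y 0 1 - x 0 1 * y 0 0) ^+ 2 = 0.
  apply/eqP; rewrite eq_le -{1}e mulr_ge0 ?sqr_ge0// andbT.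
  by move: h ab0; set a := sin _; set b := sin _ => h ab0; nra.
rewrite mulf_eq0 !expf_eq0 /= gt_eqF//= => /eqP cross.
move: (sp) (sx) (sy); rewrite !sphereE x2 y2 => sp' sx' sy'.
have : dotp x y ^+ 2 = 1.
  rewrite dotpE x2 y2.
  transitivity ((x 0 0 ^+ 2 + x 0 1 ^+ 2) * (y 0 0 ^+ 2 + y 0 1 ^+ 2)
     - (x 0 0 * y 0 1 - x 0 1 * y 0 0) ^+ 2); first ring.
  by move: sx' sy'; rewrite expr0n !addr0 cross => -> ->; ring.
move=> /eqP; rewrite sqrf_eq1 => /orP[|]/eqP xy; last by rewrite /sdist xy acosN1.
(* The remaining case [dotp x y = 1] would put [p] at distance 0 from [x], hence on the equator. *)
have exy : sdist x y = 0 by rewrite /sdist xy acos1.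
have px : sdist p x = 0 by lra.
have : dotp p x = 1 by rewrite -(cos_sdist sp sx) px cos0.
rewrite dotpE x2 mulr0 addr0 => px1.
move: sx'; rewrite expr0n addr0 => sx'; exfalso.
have := sqr_ge0 (p 0 0 - x 0 0); have := sqr_ge0 (p 0 1 - x 0 1).
by have := exprn_gt0 2 p2; nra.
Qed.

End SphereGeometry.

Arguments cpt {R} phi.

(** * Continuity and compactness on the boundary circle *)

Section Topology.
Variable R : realType.

Lemma cvg_mx (T : Type) (F : set_system T) (m n : nat)
    (f : T -> 'M[R]_(m, n)) (M : 'M[R]_(m, n)) : Filter F ->
  (forall i j, (fun x => f x i j) @ F --> M i j) -> f @ F --> M.
Proof.
move=> FF fM A [P MP PA].
have FP i j : F [set x | P i j (f x i j)] by exact: (fM i j) (MP i j).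
have {}FP i := filter_forall FF (FP i).
by apply: (filterS _ (filter_forall FF FP)) => x Px; exact: PA.
Qed.

Lemma continuous_cpt : continuous (@cpt R).
Proof.
move=> phi; apply: cvg_mx => i [[|[|[|//]]] j].
- by under eq_fun do rewrite mxE /=; rewrite mxE; exact: continuous_cos.
- by under eq_fun do rewrite mxE /=; rewrite mxE; exact: continuous_sin.
- by under eq_fun do rewrite mxE /=; rewrite mxE; exact: cvg_cst.
Qed.

Lemma compact_circle : compact (@circle R).
Proof.
have -> : @circle R = @cpt R @` `[0, pi *+ 2]%classic.
  apply/seteqP; split => [p /(circle_param 0)[phi phi02 ->]|_ [phi _ <-]].
    by exists phi => //; rewrite /= in_itv /=; lra.
  exact: circle_cpt.
apply: continuous_compact; last exact: segment_compact.
by apply: continuous_subspaceT; exact: continuous_cpt.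
Qed.

Lemma dist_le_continuous (g : R -> R) :
  (forall s t, g s <= g t + `|s - t|) -> continuous g.
Proof.
move=> gl s; apply/cvgrPdist_lt => e e0; near=> t.
have : `|s - t| < e by near: t; apply: cvgr_dist_lt.
apply: le_lt_trans; rewrite ler_norml; have := gl s t; have := gl t s.
by rewrite (distrC t s); lra.
Unshelve. all: by end_near. Qed.

End Topology.

(** * The extremal Lipschitz functions [fminus] and [fplus] *)

Section Extremal.
Variable R : realType.
Implicit Types (L : set ('rV[R]_3 * R)) (p x y : 'rV[R]_3) (q : 'rV[R]_3 * R).

Section bounded.
Variables (L : set ('rV[R]_3 * R)) (M : R).
Hypotheses (L0 : L !=set0) (LE : L `<=` @Einhat R)
  (LM : forall q, L q -> `|q.2| <= M).

Let LS q : L q -> sphere q.1. Proof. by move=> /LE[]. Qed.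

(** [sup] is an upper bound only for a set that is bounded above; the height bound [M] and the
    nonnegativity of distances ensure this. *)
Lemma le_fminus x q : sphere x -> L q -> q.2 - sdist x q.1 <= fminus L x.
Proof.
move=> sx Lq; apply: ub_le_sup; last by exists q.
exists M => _ [r Lr <-]; have := LM Lr; have := sdist_ge0 sx (LS Lr).
by rewrite ler_norml; lra.
Qed.

Lemma fminus_le x B : (forall q, L q -> q.2 - sdist x q.1 <= B) ->
  fminus L x <= B.
Proof.
move=> LB; apply: ge_sup => [|_ [q Lq <-]]; last exact: LB.
by have [q Lq] := L0; exists (q.2 - sdist x q.1), q.
Qed.

Lemma fplus_le x q : sphere x -> L q -> fplus L x <= q.2 + sdist x q.1.
Proof.
move=> sx Lq; apply: ge_inf; last by exists q.
exists (- M) => _ [r Lr <-]; have := LM Lr; have := sdist_ge0 sx (LS Lr).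
by rewrite ler_norml; lra.
Qed.

Lemma le_fplus x B : (forall q, L q -> B <= q.2 + sdist x q.1) ->
  B <= fplus L x.
Proof.
move=> LB; apply: lb_le_inf => [|_ [q Lq <-]]; last exact: LB.
by have [q Lq] := L0; exists (q.2 + sdist x q.1), q.
Qed.

Lemma fminus_lip x y : sphere x -> sphere y ->
  fminus L x <= fminus L y + sdist x y.
Proof.
move=> sx sy; apply: fminus_le => q Lq; have := le_fminus sy Lq.
by have := sdist_triangle sy sx (LS Lq); rewrite (sdistC y x); lra.
Qed.

Lemma fplus_lip x y : sphere x -> sphere y ->
  fplus L x <= fplus L y + sdist x y.
Proof.
move=> sx sy; rewrite -lerBlDr; apply: le_fplus => q Lq.
have := fplus_le sx Lq.
by have := sdist_triangle sx sy (LS Lq); lra.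
Qed.

Lemma fminus_norm x : sphere x -> `|fminus L x| <= M + pi.
Proof.
move=> sx; rewrite ler_norml; apply/andP; split.
  have [q Lq] := L0; apply: le_trans (le_fminus sx Lq).
  by have := sdist_lepi sx (LS Lq); have := LM Lq; rewrite ler_norml; lra.
apply: fminus_le => q Lq; have := sdist_ge0 sx (LS Lq); have := LM Lq.
by have := pi_ge0 R; rewrite ler_norml; lra.
Qed.

Lemma fplus_norm x : sphere x -> `|fplus L x| <= M + pi.
Proof.
move=> sx; rewrite ler_norml; apply/andP; split; last first.
  have [q Lq] := L0; apply: le_trans (fplus_le sx Lq) _.
  by have := sdist_lepi sx (LS Lq); have := LM Lq; rewrite ler_norml; lra.
apply: le_fplus => q Lq; have := sdist_ge0 sx (LS Lq); have := LM Lq.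
by have := pi_ge0 R; rewrite ler_norml; lra.
Qed.

Lemma graph_minus_neq0 : graph_minus L !=set0.
Proof. by exists (cpt 0, fminus L (cpt 0)); split => //; exact: circle_cpt. Qed.

Lemma graph_plus_neq0 : graph_plus L !=set0.
Proof. by exists (cpt 0, fplus L (cpt 0)); split => //; exact: circle_cpt. Qed.

Lemma graph_minus_norm q : graph_minus L q -> `|q.2| <= M + pi.
Proof. by move=> [[sq _] ->]; exact: fminus_norm. Qed.

Lemma graph_plus_norm q : graph_plus L q -> `|q.2| <= M + pi.
Proof. by move=> [[sq _] ->]; exact: fplus_norm. Qed.

(** The Lipschitz bound makes [f] continuous in the angle, so the graph is a continuous image of a
    segment. Compactness lets extrema over [graph_minus] and [graph_plus] be attained. *)
Lemma compact_circle_graph (f : 'rV[R]_3 -> R) :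
  (forall x y, sphere x -> sphere y -> f x <= f y + sdist x y) ->
  compact [set q | circle q.1 /\ q.2 = f q.1].
Proof.
move=> flip.
have -> : [set q | circle q.1 /\ q.2 = f q.1] =
    (fun phi => (cpt phi, f (cpt phi))) @` `[0, pi *+ 2]%classic.
  apply/seteqP; split => [[p t] /= [/(circle_param 0)[phi phi02 ->] ->]|].
    by exists phi => //; rewrite /= in_itv /=; lra.
  by move=> _ [phi _ <-]; split => //; exact: circle_cpt.
apply: continuous_compact; last exact: segment_compact.
have cf : continuous (f \o @cpt R).
  apply: dist_le_continuous => s t /=.
  apply: le_trans (flip _ _ (circle_sphere (circle_cpt s))
    (circle_sphere (circle_cpt t))) _.
  by rewrite lerD2l sdist_cpt_le.
apply: continuous_subspaceT => phi.
exact: (cvg_pair (@continuous_cpt R phi) (cf phi)).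
Qed.

Lemma compact_graph_minus : compact (graph_minus L).
Proof. by apply: compact_circle_graph; exact: fminus_lip. Qed.

Lemma compact_graph_plus : compact (graph_plus L).
Proof. by apply: compact_circle_graph; exact: fplus_lip. Qed.

Hypothesis La : achronal L.

(** Achronality bounds every competitor by [q.2], and [q] itself reaches this value. *)
Lemma fminus_achronal q : L q -> fminus L q.1 = q.2.
Proof.
move=> Lq; apply/eqP; rewrite eq_le; apply/andP; split.
  apply: fminus_le => r Lr; have := La Lr Lq.
  by rewrite (sdistC r.1) ler_norml; lra.
have := le_fminus (LS Lq) Lq; rewrite sdistxx ?subr0//; exact: LS.
Qed.

Lemma fplus_achronal q : L q -> fplus L q.1 = q.2.
Proof.
move=> Lq; apply/eqP; rewrite eq_le; apply/andP; split.
  have := fplus_le (LS Lq) Lq; rewrite sdistxx ?addr0//; exact: LS.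
apply: le_fplus => r Lr; have := La Lr Lq.
by rewrite (sdistC r.1) ler_norml; lra.
Qed.

Lemma sub_graph_minus : L `<=` graph_minus L.
Proof. by move=> q Lq; split; [exact: LE|rewrite fminus_achronal]. Qed.

Lemma sub_graph_plus : L `<=` graph_plus L.
Proof. by move=> q Lq; split; [exact: LE|rewrite fplus_achronal]. Qed.

End bounded.

(** A point of the open hemisphere is neither equal nor antipodal to a boundary point, so [acos] is
    evaluated where [continuous_acos] applies. *)
Lemma dotp_disk_circle p x : disk p -> circle x -> -1 < dotp p x < 1.
Proof.
move=> [sp p2] [sx x2]; move: (sp) (sx); rewrite !sphereE x2 dotpE x2 => {}sp {}sx.
have := exprn_gt0 2 p2.
have := sqr_ge0 (p 0 0 - x 0 0); have := sqr_ge0 (p 0 1 - x 0 1).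
have := sqr_ge0 (p 0 0 + x 0 0); have := sqr_ge0 (p 0 1 + x 0 1).
by move: sx; rewrite expr0n /=; lra.
Qed.

Lemma continuous_sdist p q : disk p -> circle q.1 ->
  {for q, continuous (fun r : 'rV[R]_3 * R => sdist p r.1)}.
Proof.
move=> dp cq; apply: (@continuous_comp _ _ _ (fun r : 'rV[R]_3 * R => dotp p r.1)).
  have cc i : (fun r : 'rV[R]_3 * R => r.1 0 i) r @[r --> q] --> q.1 0 i.
    apply: (@continuous_comp _ _ _ fst (fun x : 'rV[R]_3 => x 0 i)).
      exact: cvg_fst.
    exact: coord_continuous.
  have cm i : (fun r : 'rV[R]_3 * R => p 0 i * r.1 0 i) r @[r --> q] -->
      p 0 i * q.1 0 i.
    exact: (cvgM (cvg_cst _) (cc i)).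
  rewrite (_ : (fun r => _) = fun r : 'rV[R]_3 * R =>
      p 0 0 * r.1 0 0 + p 0 1 * r.1 0 1 + p 0 2 * r.1 0 2); last first.
    by apply/funext => r; exact: dotpE.
  exact: (cvgD (cvgD (cm 0) (cm 1)) (cm 2)).
exact: continuous_acos (dotp_disk_circle dp cq).
Qed.

Section attained.
Variable L : set ('rV[R]_3 * R).
Hypotheses (L0 : L !=set0) (LE : L `<=` @Einhat R) (Lc : compact L).

Lemma compact_norm : exists M : R, forall q, L q -> `|q.2| <= M.
Proof.
have : compact (snd @` L).
  apply: continuous_compact => //; apply: continuous_subspaceT => q.
  exact: cvg_snd.
move=> /compact_bounded[M [_ MB]]; exists (M + 1) => q Lq.
by apply: MB; [rewrite ltrDl|exists q].
Qed.

Lemma fminus_attained p : disk p ->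
  exists2 q, L q & fminus L p = q.2 - sdist p q.1.
Proof.
move=> dp; have [M LM] := compact_norm.
have [|q /set_mem Lq qmax] :=
    @compact_EVT_max _ R (fun r : 'rV[R]_3 * R => r.2 - sdist p r.1) L L0 Lc.
  apply: continuous_in_subspaceT => r /set_mem Lr.
  apply: cvgB; first exact: cvg_snd.
  exact: continuous_sdist (LE Lr).
exists q => //; apply/eqP; rewrite eq_le (le_fminus LE LM (disk_sphere dp))// andbT.
by apply: fminus_le => // r Lr; apply: qmax; exact: mem_set.
Qed.

Lemma fplus_attained p : disk p ->
  exists2 q, L q & fplus L p = q.2 + sdist p q.1.
Proof.
move=> dp; have [M LM] := compact_norm.
have [|q /set_mem Lq qmin] :=
    @compact_EVT_min _ R (fun r : 'rV[R]_3 * R => r.2 + sdist p r.1) L L0 Lc.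
  apply: continuous_in_subspaceT => r /set_mem Lr.
  apply: cvgD; first exact: cvg_snd.
  exact: continuous_sdist (LE Lr).
exists q => //; apply/eqP; rewrite eq_le (fplus_le LE LM (disk_sphere dp))//=.
by apply: le_fplus => // r Lr; apply: qmin; exact: mem_set.
Qed.

End attained.

(** Heights in an achronal set differ by at most [pi], so the set is closed in a compact
    cylinder. *)
Lemma compact_achronal L : L `<=` @Einhat R -> closed L -> achronal L -> compact L.
Proof.
move=> LE Lcl La; have [->|/set0P[q Lq]] := eqVneq L set0; first exact: compact0.
apply: (@subclosed_compact _ _
    (@circle R `*` `[q.2 - pi, q.2 + pi]%classic)) => //.
  by apply: compact_setX; [exact: compact_circle|exact: segment_compact].
move=> r Lr; split; first exact: LE.
have := La _ _ Lr Lq.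
have := sdist_lepi (circle_sphere (LE _ Lr)) (circle_sphere (LE _ Lq)).
by rewrite /= in_itv /= ler_norml; lra.
Qed.

End Extremal.

(** * Gaps of the base as open arcs of the circle *)

Section Gaps.
Variable R : realType.
Implicit Types (L : set ('rV[R]_3 * R)) (B I : set 'rV[R]_3) (p x y : 'rV[R]_3).

Lemma past_lightcone_cpt (phi psi t : R) :
  past_lightcone (cpt phi, t) (cpt psi, t - `|psi - phi|).
Proof.
exists (psi < phi), `|psi - phi|; split => //; congr pair.
rewrite turn_cpt; congr cpt; have [lt|le] := ltP psi phi.
- by rewrite ltr0_norm; lra.
- by rewrite ger0_norm; lra.
Qed.

Lemma future_lightcone_cpt (phi psi t : R) :
  future_lightcone (cpt phi, t) (cpt psi, t + `|psi - phi|).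
Proof.
exists (psi < phi), `|psi - phi|; split => //; congr pair.
rewrite turn_cpt; congr cpt; have [lt|le] := ltP psi phi.
- by rewrite ltr0_norm; lra.
- by rewrite ger0_norm; lra.
Qed.

Section arc.
Variables al be : R.
Hypotheses (albe : al < be) (bea : be < al + pi *+ 2).

Local Notation mid := ((al + be) / 2).
Local Notation hlf := ((be - al) / 2).

(* Since its boundary line meets the circle only in the endpoints of the arc,
   this half-plane separates the arc from the rest of their complement. *)
Lemma arc_halfplane p : circle p ->
  (cpt @` `]al, be[%classic) p <-> cos hlf < dotp p (cpt mid).
Proof.
have [ab ba] := (albe, bea).
move=> cp; have [phi phim ->] := circle_param (mid - pi) cp.
have h0 : 0 <= hlf <= pi by lra.
have key psi : `|psi - mid| <= pi ->
    (cos hlf < dotp (cpt psi) (cpt mid)) = (`|psi - mid| < hlf).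
  move=> le; rewrite dotp_cpt -(cos_norm (psi - _)).
  by rewrite ltr_cos ?in_itv//= normr_ge0.
split=> [[psi + <-]|].
  rewrite /= in_itv /= => psiab.
  have lt : `|psi - mid| < hlf by rewrite ltr_norml; lra.
  by rewrite key// (le_trans (ltW lt)) //; case/andP: h0.
rewrite key; last by rewrite ler_norml; lra.
rewrite ltr_norml => lt; exists phi => //.
by rewrite /= in_itv /=; lra.
Qed.

Lemma arc_boundary p : circle p -> dotp p (cpt mid) = cos hlf ->
  p = cpt al \/ p = cpt be.
Proof.
have [ab ba] := (albe, bea).
move=> cp; have [phi phim ->] := circle_param (mid - pi) cp.
rewrite dotp_cpt -(cos_norm (phi - _)) => /cos_inj; rewrite !in_itv /= normr_ge0.
have -> : `|phi - mid| <= pi by rewrite ler_norml; lra.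
have -> : 0 <= hlf <= pi by lra.
move=> /(_ isT isT); have [lt|le] := ltP phi mid.
- rewrite ltr0_norm => [e|]; last by lra.
  by left; congr cpt; lra.
- rewrite ger0_norm => [e|]; last by lra.
  by right; congr cpt; lra.
Qed.

Lemma continuous_dotpr y : continuous (fun x => dotp x y).
Proof.
move=> x; rewrite (_ : (fun x => _) = fun x : 'rV[R]_3 =>
    x 0 0 * y 0 0 + x 0 1 * y 0 1 + x 0 2 * y 0 2); last first.
  by apply/funext => z; exact: dotpE.
have cm i : (fun z : 'rV[R]_3 => z 0 i * y 0 i) z @[z --> x] --> x 0 i * y 0 i.
  exact: (cvgM (@coord_continuous R 1 3 0 i x) (cvg_cst _)).
exact: (cvgD (cvgD (cm 0) (cm 1)) (cm 2)).
Qed.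

(** If the component left the arc, the function [dotp _ (cpt mid)] would take the value [cos hlf] on
    it; on the circle this happens only at the endpoints, which lie in [B]. *)
Lemma arc_component B phi : B (cpt al) -> B (cpt be) ->
  (forall psi, al < psi < be -> ~ B (cpt psi)) -> al < phi < be ->
  connected_component (@circle R `\` B) (cpt phi) = cpt @` `]al, be[%classic.
Proof.
move=> Ba Bb nB phiab; set C := connected_component _ _.
have arcB : cpt @` `]al, be[%classic `<=` @circle R `\` B.
  move=> _ [psi + <-]; rewrite /= in_itv /= => psiab.
  by split; [exact: circle_cpt|exact: nB].
have phi_arc : (cpt @` `]al, be[%classic) (cpt phi).
  by exists phi; rewrite //= in_itv.
apply/seteqP; split; last first.
  apply: connected_component_max => //.
  apply: connected_continuous_connected.
    by apply/connected_intervalP; exact: interval_is_interval.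
  by apply: continuous_subspaceT; exact: continuous_cpt.
have CB : C `<=` @circle R `\` B by exact: connected_component_sub.
move=> p Cp; have cp := (CB p Cp).1.
apply/(arc_halfplane cp); rewrite ltNge; apply/negP => le.
have : is_interval ((fun x => dotp x (cpt mid)) @` C).
  apply/connected_intervalP; apply: connected_continuous_connected.
    exact: component_connected.
  by apply: continuous_subspaceT; exact: continuous_dotpr.
move=> /(_ (dotp p (cpt mid)) (dotp (cpt phi) (cpt mid))).
case/(_ _ _ (cos hlf)).
- by exists p.
- by exists (cpt phi) => //; apply: connected_component_refl; exact: arcB.
- by rewrite le ltW//; apply/arc_halfplane => //; exact: circle_cpt.
move=> x Cx; have [cx nBx] := CB x Cx.
by case/(arc_boundary cx) => e; move: nBx; rewrite e.
Qed.

Lemma closed_circle : closed (@circle R).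
Proof. by apply: compact_closed; [exact: norm_hausdorff|exact: compact_circle]. Qed.

Lemma closure_arc :
  closure (cpt @` `]al, be[%classic) `\` (cpt @` `]al, be[%classic) =
  [set cpt al; cpt be].
Proof.
have [ab ba] := (albe, bea); set A := cpt @` _.
have adh phi : (forall e : R, 0 < e ->
      exists2 psi : R, al < psi < be & `|phi - psi| < e) ->
    closure A (cpt phi).
  move=> h V /continuous_cpt /nbhs_ballP[e /= e0 eV].
  have [psi psiab psie] := h e e0.
  exists (cpt psi); split; first by exists psi; rewrite //= in_itv.
  exact: eV.
have end_arc phi : `|phi - mid| = hlf -> ~ A (cpt phi).
  move=> e; rewrite /A (arc_halfplane (circle_cpt phi)) dotp_cpt.
  rewrite -(cos_norm (phi - _)) e.
  by rewrite ltxx.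
apply/seteqP; split=> [p [clp nAp]|p].
  have : (@circle R `&` (fun x => dotp x (cpt mid)) @^-1` `[cos hlf, +oo[%classic) p.
    rewrite (@closure_id _ (_ `&` _)).1; last first.
      apply: closedI; first exact: closed_circle.
      apply: preimage_closed; last exact: interval_closed.
      by move=> x _; exact: continuous_dotpr.
    apply: closureS clp => x [psi psiab <-]; split; first exact: circle_cpt.
    rewrite /= in_itv /= andbT ltW//; apply/arc_halfplane; first exact: circle_cpt.
    by exists psi.
  case=> cp; rewrite /= in_itv /= andbT => le.
  apply: (arc_boundary cp); apply/eqP; rewrite eq_le le andbT leNgt; apply/negP.
  by move/(arc_halfplane cp).
case=> ->; split.
- apply: adh => e e0; exists (al + Num.min e (be - al) / 2).
    by case: (leP e (be - al)); lra.
  by rewrite ltr_norml; case: (leP e (be - al)); lra.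
- by apply: end_arc; rewrite ltr0_norm; lra.
- apply: adh => e e0; exists (be - Num.min e (be - al) / 2).
    by case: (leP e (be - al)); lra.
  by rewrite ltr_norml; case: (leP e (be - al)); lra.
- by apply: end_arc; rewrite gtr0_norm; lra.
Qed.

End arc.

(** A gap in angular coordinates. The fourth clause lifts [L] to the complementary closed arc, so
    that angles are compared as real numbers. *)
Definition gap_arc L I (al be a b : R) : Prop :=
  [/\ al < be < al + pi *+ 2, L (cpt al, a), L (cpt be, b),
    (forall q, L q -> exists2 psi : R, be <= psi <= al + pi *+ 2 & q.1 = cpt psi) &
    I = cpt @` `]al, be[%classic].

Lemma gap_arc_gap_pair L I al be a b : gap L I -> gap_arc L I al be a b ->
  gap_pair L I (cpt al, a) (cpt be, b).
Proof.
move=> gI [/andP[albe bea] La Lb _ IE]; split => //.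
by rewrite IE closure_arc.
Qed.

(** The endpoints are the angles of the base nearest to [phi] on either side; they exist because the
    base is compact. *)
Lemma gap_arc_exists L phi : L `<=` @Einhat R -> compact L -> achronal L ->
  nonelementary L -> ~ base_set L (cpt phi) ->
  exists al be a b : R, al < phi < be /\
    gap_arc L (connected_component (@circle R `\` base_set L) (cpt phi)) al be a b.
Proof.
move=> LE Lc La Lne nB.
have [q0 Lq0] : L !=set0.
  apply/set0P/eqP => L0; have [+ _] := Lne (cpt 0, 0) (circle_cpt 0).
  by apply; rewrite L0.
have Bcl : closed (base_set L).
  apply: compact_closed; first exact: norm_hausdorff.
  apply: continuous_compact Lc; apply: continuous_subspaceT => q.
  exact: cvg_fst.
have Scpt s t : compact (`[s, t]%classic `&` cpt @^-1` base_set L).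
  apply: (@subclosed_compact _ _ `[s, t]%classic) => //.
  - apply: closedI; first exact: interval_closed.
    by apply: preimage_closed => // x _; exact: continuous_cpt.
  - exact: segment_compact.
have id_cont A : {within A, continuous (@id R)}.
  by apply: continuous_subspaceT => x; exact: cvg_id.
have ex m : exists2 psi : R, m <= psi < m + pi *+ 2 & base_set L (cpt psi).
  have [psi psim e] := circle_param m (LE _ Lq0).
  by exists psi => //; exists q0.
have [|al /set_mem[/= +  Bal] almax] :=
    compact_EVT_max _ (Scpt (phi - pi *+ 2) phi) (id_cont _).
  have [psi psim Bpsi] := ex (phi - pi *+ 2); exists psi; split => //=.
  by rewrite in_itv /=; lra.
rewrite in_itv /= => al1.
have [|be /set_mem[/= + Bbe] bemin] :=
    compact_EVT_min _ (Scpt phi (phi + pi *+ 2)) (id_cont _).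
  have [psi psim Bpsi] := ex phi; exists psi; split => //=.
  by rewrite in_itv /=; lra.
rewrite in_itv /= => be1.
have alphi : al < phi.
  by rewrite lt_neqAle (andP al1).2 andbT; apply/eqP => e; move: Bal; rewrite e.
have phibe : phi < be.
  by rewrite lt_neqAle (andP be1).1 andbT; apply/eqP => e; move: Bbe; rewrite -e.
have bele : be <= al + pi *+ 2.
  apply: bemin; apply: mem_set; split; last by rewrite /= cptD2pi.
  by rewrite /= in_itv /=; lra.
have nBarc psi : al < psi < be -> ~ base_set L (cpt psi).
  move=> /andP[alpsi psibe] Bpsi; have [le|lt] := leP psi phi.
    suff : psi <= al by lra.
    by apply: almax; apply: mem_set; split => //=; rewrite in_itv /=; lra.
  suff : be <= psi by lra.
  by apply: bemin; apply: mem_set; split => //=; rewrite in_itv /=; lra.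
have Lpar q : L q -> exists2 psi : R, be <= psi <= al + pi *+ 2 & q.1 = cpt psi.
  move=> Lq; have [psi psim e] := circle_param al (LE _ Lq).
  have [alpsi|] := eqVneq al psi.
    by exists (al + pi *+ 2); [lra|rewrite cptD2pi alpsi].
  move=> ne; exists psi => //.
  have := nBarc psi; have [lt|le] := ltP psi be; last lra.
  by case; [lra|exists q].
have [[x a] Lal /= xal] := Bal; have [[y b] Lbe /= ybe] := Bbe.
(* If the two endpoints coincided on the circle, [L] would be a single point, which lies in its own
   lightcone. *)
subst x y; have {bele} belt : be < al + pi *+ 2.
  rewrite lt_neqAle bele andbT; apply/eqP => bal.
  have [+ _] := Lne _ (LE _ Lal); apply => -[x t] Lxt.
  have [psi psibe /= ex'] := Lpar _ Lxt.
  have {}ex' : x = cpt al by rewrite ex' -(cptD2pi al); congr cpt; lra.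
  have := La _ _ Lxt Lal; rewrite /= ex' sdistxx; last first.
    exact: circle_sphere (circle_cpt _).
  rewrite normr_le0 subr_eq0 => /eqP ->.
  by have := past_lightcone_cpt al al a; rewrite subrr normr0 subr0.
exists al, be, a, b; split; first lra.
split => //; first lra.
by apply: arc_component => //; lra.
Qed.

End Gaps.

(** * Rays, the bilinear form of [Q], and hulls in the space of rays *)

Section Rays.
Variable R : realType.
Implicit Types (u v w : 'rV[R]_4) (A : set (set 'rV[R]_4)).

Definition bform v w : R :=
  - (v 0 0 * w 0 0) - v 0 1 * w 0 1 + v 0 2 * w 0 2 + v 0 3 * w 0 3.

Definition pvec (q : 'rV[R]_3 * R) : 'rV[R]_4 :=
  \row_(j < 4) [:: cos q.2; sin q.2; q.1 0 0; q.1 0 1]`_j.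

Lemma row4P v w : v 0 0 = w 0 0 -> v 0 1 = w 0 1 -> v 0 2 = w 0 2 ->
  v 0 3 = w 0 3 -> v = w.
Proof.
move=> h0 h1 h2 h3; apply/rowP => -[[|[|[|[|//]]]] i].
- by rewrite (_ : Ordinal i = 0)//; exact: val_inj.
- by rewrite (_ : Ordinal i = 1)//; exact: val_inj.
- by rewrite (_ : Ordinal i = 2)//; exact: val_inj.
- by rewrite (_ : Ordinal i = 3)//; exact: val_inj.
Qed.

Lemma qformE v : qform v = bform v v.
Proof. by rewrite /qform /bform; ring. Qed.

Lemma bformDl u v w : bform (u + v) w = bform u w + bform v w.
Proof. by rewrite /bform !mxE; ring. Qed.

Lemma bformZl t v w : bform (t *: v) w = t * bform v w.
Proof. by rewrite /bform !mxE; ring. Qed.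

Lemma bformC v w : bform v w = bform w v.
Proof. by rewrite /bform; ring. Qed.

Lemma bformNr v w : bform v (- w) = - bform v w.
Proof. by rewrite /bform !mxE; ring. Qed.

Lemma bform0l w : bform 0 w = 0.
Proof. by rewrite /bform !mxE; ring. Qed.

Lemma qform_neq0 v : qform v < 0 -> v != 0.
Proof. by rewrite qformE; apply: contraTneq => ->; rewrite bform0l ltxx. Qed.

Lemma continuous_bforml w : continuous (fun v => bform v w).
Proof.
move=> v; have cm i : (fun z : 'rV[R]_4 => z 0 i * w 0 i) z @[z --> v] -->
    v 0 i * w 0 i.
  exact: (cvgM (@coord_continuous R 1 4 0 i v) (cvg_cst _)).
exact: (cvgD (cvgD (cvgB (cvgN (cm 0)) (cm 1)) (cm 2)) (cm 3)).
Qed.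

(** The first term being the cosine of the distance, the sign of the pairing compares distance with
    height difference. Only [q] has to lie over the boundary: this already cancels the third
    coordinates. *)
Lemma bform_pvec (p q : 'rV[R]_3 * R) : q.1 0 2 = 0 ->
  bform (pvec p) (pvec q) = dotp p.1 q.1 - cos (p.2 - q.2).
Proof. by move=> q2; rewrite /bform dotpE q2 !mxE /= cosB; ring. Qed.

Lemma pvec_neq0 q : pvec q != 0.
Proof.
apply/eqP => q0; have := cos2Dsin2 q.2.
have -> : cos q.2 = (0 : 'rV[R]_4) 0 0 by rewrite -q0 mxE.
have -> : sin q.2 = (0 : 'rV[R]_4) 0 1 by rewrite -q0 mxE.
by rewrite !mxE expr0n addr0 => /eqP; rewrite eq_sym oner_eq0.
Qed.

Lemma ray_self v : ray v v.
Proof. by exists 1; rewrite ?scale1r //= ltr01. Qed.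

Lemma rayZ t v : 0 < t -> ray (t *: v) = ray v.
Proof.
move=> t0; apply/seteqP; split => _ [s /= s0 <-].
  by exists (s * t); rewrite ?scalerA //= mulr_gt0.
by exists (s / t); rewrite ?scalerA ?divfK ?gt_eqF //= divr_gt0.
Qed.

Lemma ray_eq u v : ray u = ray v -> exists2 t : R, 0 < t & u = t *: v.
Proof. by move=> e; have := ray_self u; rewrite e => -[t t0 <-]; exists t. Qed.

Lemma cone_overZ A t v : 0 < t -> cone_over A v -> cone_over A (t *: v).
Proof.
by move=> t0 [v0 Av]; split; [rewrite scaler_eq0 negb_or gt_eqF|rewrite rayZ].
Qed.

(** The rays pairing positively with [w] form an open set that misses the hull, because the
    half-space [bform u w <= 0] is convex. *)
Lemma ray_closure_hull_le A v w : v != 0 ->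
  (forall u, cone_over A u -> bform u w <= 0) ->
  ray_closure (ray_hull A) (ray v) -> bform v w <= 0.
Proof.
move=> v0 Aw [_ clv]; rewrite leNgt; apply/negP => vw.
pose U := [set ray u | u in [set u | 0 < bform u w]].
have UE : cone_over U = [set u | 0 < bform u w].
  apply/seteqP; split=> [u [u0 [u' /= u'w /esym/ray_eq[t t0 ->]]]|u /= uw].
    by rewrite /= bformZl mulr_gt0.
  split; last by exists u.
  by apply: contraTneq uw => ->; rewrite bform0l ltxx.
have [||_ [[u /= uw <-] [h [h0 hA] /ray_eq[t t0 e]]]] := clv U.
- split; first by move=> _ [u uw <-]; exists u => //; rewrite -UE in uw; case: uw.
  rewrite UE; apply: (@open_comp _ _ (fun u => bform u w) [set x | 0 < x]) => //.
  by move=> u _; exact: continuous_bforml.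
- by exists v.
have : bform h w <= 0.
  apply: (hA [set u | bform u w <= 0]); split => // x y l.
  rewrite !inE /= => xw yw; rewrite /conv /= bformDl !bformZl.
  have l1 : 0 <= 1 - l%:num by rewrite subr_ge0 le1.
  by rewrite -oppr_ge0 opprD addr_ge0// -mulrN mulr_ge0// oppr_ge0.
by rewrite leNgt e bformZl pmulr_rgt0// uw.
Qed.

(** The half-space bound holds vacuously for [w] and [- w], so [v] would pair to zero with every
    vector. *)
Lemma ray_closure_set0 v : v != 0 -> ~ ray_closure (ray_hull set0) (ray v).
Proof.
move=> v0 cl; have w0 w : bform v w = 0.
  apply/eqP; rewrite eq_le (@ray_closure_hull_le set0 v w)//=; last by move=> u [].
  have := @ray_closure_hull_le set0 v (- w) v0 (fun u => _) cl.
  rewrite (bformC v (- w)) -scaleN1r bformZl mulN1r oppr_le0 bformC.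
  by apply => u [].
move/eqP: v0; apply; apply: row4P; rewrite !mxE.
- by have := w0 (delta_mx 0 0); rewrite /bform !mxE /=; lra.
- by have := w0 (delta_mx 0 1); rewrite /bform !mxE /=; lra.
- by have := w0 (delta_mx 0 2); rewrite /bform !mxE /=; lra.
- by have := w0 (delta_mx 0 3); rewrite /bform !mxE /=; lra.
Qed.

Lemma convex_hull_sum4 A v1 v2 v3 v4 :
  cone_over A v1 -> cone_over A v2 -> cone_over A v3 -> cone_over A v4 ->
  smallest (@convex_set R 'rV[R]_4) (cone_over A) (v1 + v2 + v3 + v4).
Proof.
move=> A1 A2 A3 A4 C [Ccvx AC].
have h0 : 0 <= 2^-1 :> R by lra.
have h1 : 2^-1 <= 1 :> R by lra.
have mean u v : C u -> C v -> C (2^-1 *: (u + v)).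
  move=> Cu Cv; have := Ccvx u v (Itv01 h0 h1); rewrite !inE => /(_ Cu Cv).
  rewrite /conv /=; suff -> : 2^-1 *: (u + v) = 2^-1 *: u + (1 - 2^-1) *: v by [].
  by rewrite scalerDr; congr (_ + _ *: _); lra.
have C4 v : cone_over A v -> C (4 *: v) by move=> Av; apply: AC; exact: cone_overZ.
have := mean _ _ (mean _ _ (C4 _ A1) (C4 _ A2)) (mean _ _ (C4 _ A3) (C4 _ A4)).
rewrite -!scalerDr !scalerA !addrA.
by rewrite (_ : _ * _ = 1) ?scale1r//; lra.
Qed.

End Rays.

(** * Null coordinates and the tetrahedron spanned by a diamond *)

Section Tetrahedron.
Variable R : realType.
Implicit Types (A B : R) (v w : 'rV[R]_4).

(* Null coordinates on the Einstein universe: A = (theta + phi) / 2 and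
   B = (theta - phi) / 2 are constant along lightlike geodesics. *)
Definition npt A B : 'rV[R]_3 * R := (cpt (A - B), A + B).

Definition nvec A B := pvec (npt A B).

Lemma nvecE A B :
  (nvec A B 0 0 = cos (A + B)) * (nvec A B 0 1 = sin (A + B)) *
  (nvec A B 0 2 = cos (A - B)) * (nvec A B 0 3 = sin (A - B)).
Proof. by rewrite /nvec /pvec !mxE. Qed.

Lemma bform_nvec A B A' B' :
  bform (nvec A B) (nvec A' B') = 2 * (sin (A - A') * sin (B - B')).
Proof.
by rewrite /bform !nvecE !sinB !cosB !cosD !sinD; ring.
Qed.

Lemma continuous_nvec (f g : R -> R) : continuous f -> continuous g ->
  continuous (fun e => nvec (f e) (g e)).
Proof.
move=> cf cg e.
have cD : f x + g x @[x --> e] --> f e + g e by exact: (cvgD (cf e) (cg e)).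
have cB : f x - g x @[x --> e] --> f e - g e by exact: (cvgB (cf e) (cg e)).
have ccos (h : R -> R) (l : R) : h x @[x --> e] --> l ->
    cos (h x) @[x --> e] --> cos l.
  by move=> hl; apply: continuous_cvg => //; exact: continuous_cos.
have csin (h : R -> R) (l : R) : h x @[x --> e] --> l ->
    sin (h x) @[x --> e] --> sin l.
  by move=> hl; apply: continuous_cvg => //; exact: continuous_sin.
apply: cvg_mx => i k; rewrite [i]ord1; under eq_fun do rewrite mxE; rewrite mxE.
case: k => [[|[|[|[|//]]]] k] /=.
- exact: (ccos _ _ cD).
- exact: (csin _ _ cD).
- by under eq_fun do rewrite cptE; rewrite cptE; exact: (ccos _ _ cB).
- by under eq_fun do rewrite cptE; rewrite cptE; exact: (csin _ _ cB).
Qed.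

Variables A0 A1 B0 B1 : R.

Lemma combination4E (a b c d : R) (x y z w : 'rV[R]_4) (i : 'I_4) :
  (a *: x + b *: y + c *: z + d *: w) 0 i =
  a * x 0 i + b * y 0 i + c * z 0 i + d * w 0 i.
Proof. by rewrite !mxE. Qed.

(** Each corner of the rectangle pairs to zero with itself and its neighbours, so the coordinates of
    [v] are read off by pairing with the opposite corners. *)
Lemma nvec_decomposition v : (2 * sin (A1 - A0) * sin (B1 - B0)) *: v =
  (- bform v (nvec A1 B0)) *: nvec A0 B1 + (- bform v (nvec A0 B1)) *: nvec A1 B0
  + bform v (nvec A0 B0) *: nvec A1 B1 + bform v (nvec A1 B1) *: nvec A0 B0.
Proof.
apply: row4P; rewrite combination4E [LHS]mxE /bform !nvecE !sinB;
  by rewrite ?cosB ?cosD ?sinD; ring.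
Qed.

Lemma bform_decomposition v w : 2 * sin (A1 - A0) * sin (B1 - B0) * bform v w =
  - (bform v (nvec A1 B0) * bform (nvec A0 B1) w)
  - bform v (nvec A0 B1) * bform (nvec A1 B0) w
  + bform v (nvec A0 B0) * bform (nvec A1 B1) w
  + bform v (nvec A1 B1) * bform (nvec A0 B0) w.
Proof. by rewrite -bformZl nvec_decomposition !bformDl !bformZl; ring. Qed.

(** [nvec] is bilinear in [(cos A, sin A)] and [(cos B, sin B)]; the formula multiplies the planar
    expansions of these vectors at the end values of the two intervals. *)
Lemma nvec_combination A B : (sin (A1 - A0) * sin (B1 - B0)) *: nvec A B =
  (sin (A1 - A) * sin (B - B0)) *: nvec A0 B1
  + (sin (A - A0) * sin (B1 - B)) *: nvec A1 B0
  + (sin (A - A0) * sin (B - B0)) *: nvec A1 B1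
  + (sin (A1 - A) * sin (B1 - B)) *: nvec A0 B0.
Proof.
apply: row4P; rewrite combination4E [LHS]mxE !nvecE !sinB;
  by rewrite ?cosB ?cosD ?sinD; ring.
Qed.

(** [w] is the limit of [F t] for small [t]: raising the coefficients by [t] and moving the corners
    inwards by [t] gives positive combinations of points of the open diamond. *)
Lemma nonneg_combination_closure (D : set (set 'rV[R]_4)) (a b c d : R) w :
  A0 < A1 -> B0 < B1 ->
  (forall A B, A0 < A < A1 -> B0 < B < B1 -> D (ray (nvec A B))) ->
  0 <= a -> 0 <= b -> 0 <= c -> 0 <= d ->
  w = a *: nvec A0 B1 + b *: nvec A1 B0 + c *: nvec A1 B1 + d *: nvec A0 B0 ->
  w != 0 -> ray_closure (ray_hull D) (ray w).
Proof.
move=> A01 B01 DN ha hb hc hd e w0; split; first by exists w.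
move=> U [Usub Uopen] Uw.
pose F (t : R) :=
  (a + t) *: nvec (A0 + t) (B1 - t) + (b + t) *: nvec (A1 - t) (B0 + t)
  + (c + t) *: nvec (A1 - t) (B1 - t) + (d + t) *: nvec (A0 + t) (B0 + t).
have cF : continuous F.
  have cp (x : R) : continuous (fun t => x + t).
    by move=> t; exact: (cvgD (cvg_cst _) cvg_id).
  have cm (x : R) : continuous (fun t => x - t).
    by move=> t; exact: (cvgB (cvg_cst _) cvg_id).
  have term (x : R) (f : R -> 'rV[R]_4) : continuous f ->
      continuous (fun t => (x + t) *: f t).
    by move=> cf t; exact: (cvgZ (cp x t) (cf t)).
  move=> t; apply: (cvgD (cvgD (cvgD (term a _ _ t) (term b _ _ t)) (term c _ _ t))
    (term d _ _ t)); exact: continuous_nvec.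
have F0 : F 0 = w by rewrite e /F !addr0 !subr0.
have : nbhs (F 0) (cone_over U) by rewrite F0; apply: open_nbhs_nbhs; split.
move=> /cF /nbhs_ballP[r /= r0 rU].
(* The bound [r / 2] keeps [F t] in the given neighbourhood, the half-widths keep the moved corners
   inside the rectangle. *)
pose t := Num.min (r / 2) (Num.min ((A1 - A0) / 2) ((B1 - B0) / 2)).
have t0 : 0 < t by rewrite !lt_min; apply/and3P; split; lra.
have tr : t <= r / 2 by rewrite ge_min lexx.
have tA : t <= (A1 - A0) / 2 by rewrite !ge_min lexx !orbT.
have tB : t <= (B1 - B0) / 2 by rewrite !ge_min lexx !orbT.
have [Ft0 UFt] : cone_over U (F t).
  by apply: rU; rewrite /ball /= sub0r normrN gtr0_norm//; lra.
exists (ray (F t)); split => //; exists (F t) => //; split => //.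
have Dcone x A B : 0 <= x -> A0 < A < A1 -> B0 < B < B1 ->
    cone_over D ((x + t) *: nvec A B).
  move=> x0 hA hB; apply: cone_overZ; first by rewrite ltr_wpDl.
  by split; [exact: pvec_neq0|exact: DN].
by apply: convex_hull_sum4; apply: Dcone => //; lra.
Qed.

Lemma tetrahedron_sub_closure (D : set (set 'rV[R]_4)) v :
  A0 < A1 -> B0 < B1 -> 0 < sin (A1 - A0) -> 0 < sin (B1 - B0) -> v != 0 ->
  (forall A B, A0 < A < A1 -> B0 < B < B1 -> D (ray (nvec A B))) ->
  bform v (nvec A1 B0) <= 0 -> bform v (nvec A0 B1) <= 0 ->
  0 <= bform v (nvec A0 B0) -> 0 <= bform v (nvec A1 B1) ->
  ray_closure (ray_hull D) (ray v).
Proof.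
move=> A01 B01 SA SB v0 DN h10 h01 h00 h11.
have k0 : 0 < 2 * sin (A1 - A0) * sin (B1 - B0) by rewrite !mulr_gt0.
rewrite -(rayZ v k0).
apply: (nonneg_combination_closure A01 B01 DN _ _ _ _ (nvec_decomposition v)) => //.
- by rewrite oppr_ge0.
- by rewrite oppr_ge0.
- by rewrite scaler_eq0 negb_or v0 gt_eqF.
Qed.

End Tetrahedron.

(** * The invisible domain described by pairings with [L] *)

Section Invisible.
Variable R : realType.
Implicit Types (L : set ('rV[R]_3 * R)) (v : 'rV[R]_4) (s t d : R).

(** Past [pi] the cosine increases again, but up to [2 pi - d] it stays at most [cos d], so there
    both sides are false. *)
Lemma cos_lt_norm d t : 0 <= d <= pi -> `|t| <= pi *+ 2 - d ->
  (cos d < cos t) = (`|t| < d).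
Proof.
move=> dpi td; rewrite -(cos_norm t); have t0 := normr_ge0 t.
have [le|lt] := leP `|t| pi; first by rewrite ltr_cos ?in_itv//= t0.
rewrite -(cos_sub2pi `|t|) ltr_cos ?in_itv //=; last by lra.
by apply/idP/idP; lra.
Qed.

Lemma bform_invisible L p t q : L `<=` @Einhat R -> compact L -> disk p ->
  fminus L p < t < fplus L p -> L q -> bform (pvec (p, t)) (pvec q) < 0.
Proof.
move=> LE Lc dp /andP[lt1 lt2] Lq; have sp := disk_sphere dp.
have cq := LE q Lq; have sq := circle_sphere cq.
have [M LM] := compact_norm Lc.
have h1 := le_fminus LE LM sp Lq; have h2 := fplus_le LE LM sp Lq.
have d0 := sdist_ge0 sp sq; have dpi := sdist_lepi sp sq.
rewrite bform_pvec ?(proj2 cq)//= -cos_sdist// subr_lt0 cos_lt_norm; first last.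
- by rewrite ler_norml; lra.
- by rewrite d0.
- by rewrite ltr_norml; lra.
Qed.

(** [v] is rescaled to [pvec (p, t)], which fixes [t] only modulo [2 pi]. A lift close to one point
    of [L] is chosen and then shown to suit all of [L]. *)
Lemma invisible_bform L v : L !=set0 -> L `<=` @Einhat R -> compact L ->
  achronal L -> qform v < 0 -> (forall q, L q -> bform v (pvec q) < 0) ->
  invisible_domain L (ray v).
Proof.
move=> L0 LE Lc La vQ vL; have [q0 Lq0] := L0.
set rho2 := v 0 0 ^+ 2 + v 0 1 ^+ 2.
have rho2E : v 0 2 ^+ 2 + v 0 3 ^+ 2 < rho2.
  by move: vQ; rewrite /qform /rho2; lra.
have rho20 : 0 < rho2.
  by apply: le_lt_trans rho2E; rewrite addr_ge0 ?sqr_ge0.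
set rho := Num.sqrt rho2.
have rho0 : 0 < rho by rewrite sqrtr_gt0.
have rhoS : rho ^+ 2 = rho2 by rewrite sqr_sqrtr// ltW.
(* The window is centred at the height of [q0], so [t - q0.2] has absolute value at most [pi]. *)
have [|t [tm ct st]] := @angle_exists R (q0.2 - pi) (v 0 0 / rho) (v 0 1 / rho).
  by rewrite !expr_div_n -mulrDl rhoS divff// gt_eqF.
set z2 := 1 - (v 0 2 / rho) ^+ 2 - (v 0 3 / rho) ^+ 2.
have z20 : 0 < z2.
  by rewrite /z2 !expr_div_n rhoS -addrA -opprD -mulrDl subr_gt0 ltr_pdivrMr ?mul1r.
pose p : 'rV[R]_3 := \row_(j < 3) [:: v 0 2 / rho; v 0 3 / rho; Num.sqrt z2]`_j.
have dp : disk p.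
  split; last by rewrite mxE /= sqrtr_gt0.
  by rewrite sphereE !mxE /= sqr_sqrtr ?ltW// /z2; ring.
have sp := disk_sphere dp.
have vE : v = rho *: pvec (p, t).
  by apply: row4P; rewrite !mxE /= ?ct ?st ?mxE /= mulrC divfK// gt_eqF.
have cosL q : L q -> cos (sdist p q.1) < cos (t - q.2).
  move=> Lq; have cq := LE q Lq; have := vL q Lq.
  rewrite vE bformZl pmulr_rlt0// bform_pvec ?(proj2 cq)//= subr_lt0.
  by rewrite cos_sdist//; exact: circle_sphere.
have s0 := circle_sphere (LE _ Lq0).
have near0 : `|t - q0.2| < sdist p q0.1.
  have d0 := sdist_ge0 sp s0; have dpi := sdist_lepi sp s0.
  have tpi : `|t - q0.2| <= pi by rewrite ler_norml; lra.
  by rewrite -cos_lt_norm ?cosL ?d0//; lra.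
have near q : L q -> `|t - q.2| < sdist p q.1.
  move=> Lq; have sq := circle_sphere (LE _ Lq).
  have d0 := sdist_ge0 sp sq; have dpi := sdist_lepi sp sq.
  rewrite -cos_lt_norm ?cosL ?d0//.
  (* Going through [q0], the height difference to [q] is at most [sdist p q0.1 + sdist q0.1 q.1],
     hence by the perimeter bound in the range of [cos_lt_norm]. *)
  have := sdist_perimeter sp s0 sq; have := La _ _ Lq0 Lq.
  by move: near0; rewrite ltr_norml !ler_norml; lra.
rewrite vE rayZ//; exists (p, t) => //; split => //=.
have [q1 Lq1 ->] := fminus_attained L0 LE Lc dp.
have [q2 Lq2 ->] := fplus_attained L0 LE Lc dp.
have := near _ Lq1; have := near _ Lq2; rewrite !ltr_norml; lra.
Qed.

Lemma past_lightcone_npt (A B A' B' : R) :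
  (A = A' /\ B' <= B) \/ (B = B' /\ A' <= A) ->
  past_lightcone (npt A B) (npt A' B').
Proof.
move=> h; rewrite /npt.
suff -> : A' + B' = A + B - `|A' - B' - (A - B)| by exact: past_lightcone_cpt.
by case: h => -[<- le]; [rewrite ger0_norm|rewrite ler0_norm]; lra.
Qed.

Lemma future_lightcone_npt (A B A' B' : R) :
  (A = A' /\ B <= B') \/ (B = B' /\ A <= A') ->
  future_lightcone (npt A B) (npt A' B').
Proof.
move=> h; rewrite /npt.
suff -> : A' + B' = A + B + `|A' - B' - (A - B)| by exact: future_lightcone_cpt.
by case: h => -[<- le]; [rewrite ler0_norm|rewrite ger0_norm]; lra.
Qed.

End Invisible.

(** * Causal geometry of [L] around one gap *)

Section GapAnalysis.
Variables (R : realType) (L : set ('rV[R]_3 * R)) (I : set 'rV[R]_3).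
Variables (al be a b : R).
Hypotheses (LE : L `<=` @Einhat R) (Lc : compact L) (La : achronal L).
Hypothesis gapI : gap_arc L I al be a b.

(** The endpoints of the gap are [(A0, B1)] and [(A1, B0)] in null coordinates; the lower and upper
    corners of the diamond are [(A0, B0)] and [(A1, B1)]. *)
Let A0 := (a + al) / 2.
Let A1 := (b + be) / 2.
Let B0 := (b - be) / 2.
Let B1 := (a - al) / 2.

Lemma npt_corners : npt A0 B1 = (cpt al, a) /\ npt A1 B0 = (cpt be, b).
Proof.
by rewrite /npt /A0 /A1 /B0 /B1; split; congr (cpt _, _); field.
Qed.

(* In null coordinates, [L] lies in the rectangle spanned by the endpoints of
   the gap on the side opposite to it. *)
Lemma gap_arc_npt q : L q -> exists A B : R,
  [/\ q = npt A B, A1 <= A <= A0 + pi & B1 - pi <= B <= B0].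
Proof.
have [/andP[ab ba] Lal Lbe Lpar _] := gapI.
case: q => x t Lq; have [psi psib /= ex] := Lpar _ Lq; subst x.
exists ((t + psi) / 2), ((t - psi) / 2).
have := La Lq Lbe; have := La Lq Lal; rewrite /= !ler_norml => h1 h2.
have h3 := sdist_cpt_le psi be.
have h4 : sdist (cpt psi) (cpt al) <= pi *+ 2 - (psi - al).
  by rewrite sdistC; apply: sdist_cpt_le2pi; lra.
rewrite ger0_norm in h3; last by lra.
split; first by rewrite /npt; congr (cpt _, _); field.
- by rewrite /A0 /A1; lra.
- by rewrite /B0 /B1; lra.
Qed.

(** The shorter arc from [phi] to a point of [L] passes through an endpoint of the gap, and the
    rectangle containing [L] makes that point contribute no more than the endpoint. *)
Lemma fminus_gap phi : al < phi < be ->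
  fminus L (cpt phi) = Num.max (a - (phi - al)) (b - (be - phi)).
Proof.
move=> phiab; have [/andP[ab ba] Lal Lbe Lpar _] := gapI.
have [M LM] := compact_norm Lc.
have sphi := circle_sphere (circle_cpt phi).
have L0 : L !=set0 by exists (cpt al, a).
apply/eqP; rewrite eq_le; apply/andP; split; last first.
  rewrite ge_max; apply/andP; split.
    apply: le_trans (le_fminus LE LM sphi Lal) => /=.
    by have := sdist_cpt_le phi al; rewrite ger0_norm; lra.
  apply: le_trans (le_fminus LE LM sphi Lbe) => /=.
  by have := sdist_cpt_le phi be; rewrite ler0_norm; lra.
apply: (fminus_le L0) => q Lq; have [A [B [-> hA hB]]] := gap_arc_npt Lq.
rewrite /A0 /A1 /B0 /B1 in hA hB; rewrite le_max /=.
have le1 : phi <= A - B by lra.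
have le2 : A - B <= phi + pi *+ 2 by lra.
rewrite sdist_cpt_min//.
by (case: (leP (A - B - phi)) => _; apply/orP); [right; lra|left; lra].
Qed.

Lemma fplus_gap phi : al < phi < be ->
  fplus L (cpt phi) = Num.min (a + (phi - al)) (b + (be - phi)).
Proof.
move=> phiab; have [/andP[ab ba] Lal Lbe Lpar _] := gapI.
have [M LM] := compact_norm Lc.
have sphi := circle_sphere (circle_cpt phi).
have L0 : L !=set0 by exists (cpt al, a).
apply/eqP; rewrite eq_le; apply/andP; split.
  rewrite le_min; apply/andP; split.
    apply: le_trans (fplus_le LE LM sphi Lal) _ => /=.
    by have := sdist_cpt_le phi al; rewrite ger0_norm; lra.
  apply: le_trans (fplus_le LE LM sphi Lbe) _ => /=.
  by have := sdist_cpt_le phi be; rewrite ler0_norm; lra.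
apply: (le_fplus L0) => q Lq; have [A [B [-> hA hB]]] := gap_arc_npt Lq.
rewrite /A0 /A1 /B0 /B1 in hA hB; rewrite ge_min /=.
have le1 : phi <= A - B by lra.
have le2 : A - B <= phi + pi *+ 2 by lra.
rewrite sdist_cpt_min//.
by (case: (leP (A - B - phi)) => _; apply/orP); [right; lra|left; lra].
Qed.

Lemma diamond_npt (A B : R) : A0 < A < A1 -> B0 < B < B1 ->
  diamond L I (ray (nvec A B)).
Proof.
rewrite /A0 /A1 /B0 /B1 => hA hB; have [_ _ _ _ ->] := gapI.
exists (npt A B) => //; split => /=.
  by exists (A - B) => //=; rewrite in_itv /=; lra.
by rewrite fminus_gap ?fplus_gap ?gt_max ?lt_min; lra.
Qed.

Lemma diamond_inv v : cone_over (diamond L I) v -> exists A B t : R,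
  [/\ 0 < t, v = t *: nvec A B, A0 < A < A1 & B0 < B < B1].
Proof.
have [_ _ _ _ IE] := gapI.
move=> [_ [[x s] /= [+ hs] /esym/ray_eq[t t0 ->]]].
rewrite IE => -[phi]; rewrite /= in_itv /= => phiab ex; subst x.
move: hs; rewrite fminus_gap ?fplus_gap// gt_max lt_min => hs.
exists ((s + phi) / 2), ((s - phi) / 2), t; split => //.
- rewrite /nvec (_ : npt _ _ = (cpt phi, s))//.
  by rewrite /npt; congr (cpt _, _); field.
- by rewrite /A0 /A1; lra.
- by rewrite /B0 /B1; lra.
Qed.

Lemma achronal_npt (A B A' B' : R) : L (npt A B) -> L (npt A' B') ->
  `|(A + B) - (A' + B')| <= `|(A - B) - (A' - B')|.
Proof. by move=> h h'; apply: le_trans (La h h') (sdist_cpt_le _ _). Qed.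

Hypothesis Lne : nonelementary L.

Lemma nonelementary_past (A B : R) : ~ (forall A' B' : R, L (npt A' B') ->
  A1 <= A' <= A0 + pi -> B1 - pi <= B' <= B0 ->
  (A = A' /\ B' <= B) \/ (B = B' /\ A' <= A)).
Proof.
move=> h; have [+ _] := @Lne (npt A B) (circle_cpt _); apply => q Lq.
have [A' [B' [e hA hB]]] := gap_arc_npt Lq; subst q.
by apply: past_lightcone_npt; exact: h.
Qed.

Lemma nonelementary_future (A B : R) : ~ (forall A' B' : R, L (npt A' B') ->
  A1 <= A' <= A0 + pi -> B1 - pi <= B' <= B0 ->
  (A = A' /\ B <= B') \/ (B = B' /\ A <= A')).
Proof.
move=> h; have [_ +] := @Lne (npt A B) (circle_cpt _); apply => q Lq.
have [A' [B' [e hA hB]]] := gap_arc_npt Lq; subst q.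
by apply: future_lightcone_npt; exact: h.
Qed.

(** A width of at least [pi] would shrink [[A1, A0 + pi]] or [[B1 - pi, B0]] to at most one value,
    placing [L] on a lightlike ray from [(A1, B0)]. *)
Lemma gap_width_ltpi : A1 - A0 < pi /\ B1 - B0 < pi.
Proof.
split; rewrite ltNge; apply/negP => le.
  by apply: (@nonelementary_past A1 B0) => A' B' _ hA hB; left; lra.
by apply: (@nonelementary_future A1 B0) => A' B' _ hA hB; right; lra.
Qed.

(** Both null coordinates are maximal at this corner. If it belonged to [L], achronality would force
    every point of [L] to share one of them with it, hence to lie in its past lightcone. *)
Lemma upper_corner_notin : ~ L (npt (A0 + pi) B0).
Proof.
move=> Lc'; apply: (@nonelementary_past (A0 + pi) B0) => A' B' L' hA hB.
have := achronal_npt Lc' L'; rewrite ger0_norm; last by lra.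
case: (leP 0 (A0 + pi - B0 - (A' - B'))) => h.
- by rewrite ger0_norm// => ?; right; lra.
- by rewrite ltr0_norm// => ?; left; lra.
Qed.

Lemma lower_corner_notin : ~ L (npt A1 (B1 - pi)).
Proof.
move=> Lc'; apply: (@nonelementary_future A1 (B1 - pi)) => A' B' L' hA hB.
have := achronal_npt Lc' L'; rewrite ler0_norm; last by lra.
case: (leP 0 (A1 - (B1 - pi) - (A' - B'))) => h.
- by rewrite ger0_norm// => ?; left; lra.
- by rewrite ltr0_norm// => ?; right; lra.
Qed.

Lemma closed_end_invisible r : closed_end L I r -> invisible_domain L r.
Proof.
move=> [[v /= vQ <-] cl]; have v0 := qform_neq0 vQ.
have L0 : L !=set0 by have [_ Lal _ _ _] := gapI; exists (cpt al, a).
have [wA wB] := gap_width_ltpi.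
(* The closed hull of an empty diamond contains no ray, so the diamond has a point and both widths
   are positive. *)
have [A01 B01] : A0 < A1 /\ B0 < B1.
  have /set0P[r0 [q hq _]] : diamond L I != set0.
    by apply/eqP => d0; move: cl; rewrite d0; exact: ray_closure_set0.
  have [|A [B [t [_ _ hA hB]]]] := @diamond_inv (pvec q); last by lra.
  by split; [exact: pvec_neq0|exists q].
have SA : 0 < sin (A1 - A0) by rewrite sin_gt0_pi//; lra.
have SB : 0 < sin (B1 - B0) by rewrite sin_gt0_pi//; lra.
have h01 : bform v (nvec A0 B1) <= 0.
  apply: ray_closure_hull_le cl => // u /diamond_inv[A [B [t [t0 -> hA hB]]]].
  rewrite bformZl bform_nvec -(opprB B1) sinN mulrN !mulrN oppr_le0.
  by rewrite !mulr_ge0 ?ltW ?sin_gt0_pi//; lra.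
have h10 : bform v (nvec A1 B0) <= 0.
  apply: ray_closure_hull_le cl => // u /diamond_inv[A [B [t [t0 -> hA hB]]]].
  rewrite bformZl bform_nvec -(opprB A1) sinN mulNr !mulrN oppr_le0.
  by rewrite !mulr_ge0 ?ltW ?sin_gt0_pi//; lra.
have h00 : 0 <= bform v (nvec A0 B0).
  rewrite -oppr_le0 -bformNr.
  apply: ray_closure_hull_le cl => // u /diamond_inv[A [B [t [t0 -> hA hB]]]].
  rewrite bformNr bformZl bform_nvec oppr_le0.
  by rewrite !mulr_ge0 ?ltW ?sin_gt0_pi//; lra.
have h11 : 0 <= bform v (nvec A1 B1).
  rewrite -oppr_le0 -bformNr.
  apply: ray_closure_hull_le cl => // u /diamond_inv[A [B [t [t0 -> hA hB]]]].
  rewrite bformNr bformZl bform_nvec oppr_le0 -(opprB A1) -(opprB B1) !sinN mulrNN.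
  by rewrite !mulr_ge0 ?ltW ?sin_gt0_pi//; lra.
have k0 : 0 < 2 * sin (A1 - A0) * sin (B1 - B0) by rewrite !mulr_gt0.
(* Up to a positive factor, [Q(v)] is the product of the coordinates along the corners [z+], [z-]
   minus that along the endpoints; hence the latter is positive. *)
have prod_gt0 : 0 < bform v (nvec A1 B0) * bform v (nvec A0 B1).
  have := bform_decomposition A0 A1 B0 B1 v v.
  rewrite !(bformC (nvec _ _) v) => e.
  have : 2 * sin (A1 - A0) * sin (B1 - B0) * bform v v < 0.
    by rewrite pmulr_rlt0// -qformE.
  by rewrite e; have := mulr_ge0 h00 h11; lra.
have {}h10 : bform v (nvec A1 B0) < 0.
  rewrite lt_neqAle h10 andbT; apply: contraTneq prod_gt0 => ->.
  by rewrite mul0r ltxx.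
have {}h01 : bform v (nvec A0 B1) < 0.
  rewrite lt_neqAle h01 andbT; apply: contraTneq prod_gt0 => ->.
  by rewrite mulr0 ltxx.
apply: invisible_bform => // q Lq; have [A [B [e hA hB]]] := gap_arc_npt Lq.
subst q; rewrite -(pmulr_rlt0 _ k0) bform_decomposition !bform_nvec.
rewrite -!(opprB A) !sinN !mulNr.
have sA0 : 0 <= sin (A - A0) by rewrite sin_ge0_pi//; lra.
have sA1 : 0 <= sin (A - A1) by rewrite sin_ge0_pi//; lra.
have sB0 : 0 <= sin (B0 - B) by rewrite sin_ge0_pi//; lra.
have sB1 : 0 <= sin (B1 - B) by rewrite sin_ge0_pi//; lra.
have t00 := mulr_ge0 h11 (mulr_ge0 sA0 sB0).
have t11 := mulr_ge0 h00 (mulr_ge0 sA1 sB1).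
have t01 := mulr_le0_ge0 (ltW h10) (mulr_ge0 sA0 sB1).
have t10 := mulr_le0_ge0 (ltW h01) (mulr_ge0 sA1 sB0).
(* All four terms are nonpositive. The two carried by the endpoints vanish together only at
   [(A0 + pi, B0)] and [(A1, B1 - pi)], which are not in [L]. *)
have [] : (A < A0 + pi /\ B1 - pi < B) \/ (A1 < A /\ B < B0).
  have [eA|nA] := eqVneq A (A0 + pi).
    right; split; first by lra.
    rewrite lt_neqAle (andP hB).2 andbT; apply/eqP => eB.
    by apply: upper_corner_notin; rewrite -eA -eB.
  have [eB|nB] := eqVneq B (B1 - pi).
    right; split; last by lra.
    rewrite lt_neqAle (andP hA).1 andbT; apply/eqP => eA.
    by apply: lower_corner_notin; rewrite eA -eB.
  by left; lra.
- move=> [ltA ltB].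
  have : bform v (nvec A1 B0) * (sin (A - A0) * sin (B1 - B)) < 0.
    by rewrite nmulr_rlt0// mulr_gt0// sin_gt0_pi//; lra.
  by lra.
- move=> [ltA ltB].
  have : bform v (nvec A0 B1) * (sin (A - A1) * sin (B0 - B)) < 0.
    by rewrite nmulr_rlt0// mulr_gt0// sin_gt0_pi//; lra.
  by lra.
Qed.

Section point.
Variables (p : 'rV[R]_3) (t : R).
Hypotheses (dp : disk p) (pt : fminus L p < t < fplus L p).

Let v := pvec (p, t).

Let pv q : L q -> bform v (pvec q) < 0.
Proof. by move=> Lq; exact: bform_invisible pt Lq. Qed.

Let L0 : L !=set0.
Proof. by have [_ Lal _ _ _] := gapI; exists (cpt al, a). Qed.

(** The height difference is at least [sdist p q]; comparing through a point of [L] and using the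
    perimeter bound, it is at most [2 pi - sdist p q], where the cosine comparison is valid. *)
Lemma bform_future q : circle q -> fminus L q + sdist p q <= t ->
  0 <= bform v (pvec (q, fminus L q)).
Proof.
move=> cq le; have [M LM] := compact_norm Lc; have sq := circle_sphere cq.
have sp := disk_sphere dp; have [r Lr] := L0; have sr := circle_sphere (LE Lr).
have h1 := le_fminus LE LM sq Lr; have h2 := fplus_le LE LM sp Lr.
have h3 := sdist_perimeter sp sq sr.
have d0 := sdist_ge0 sp sq; have dpi := sdist_lepi sp sq.
have [_ lt] := andP pt.
rewrite bform_pvec ?(proj2 cq)//= -cos_sdist// subr_ge0 leNgt cos_lt_norm.
- by rewrite -leNgt ger0_norm; lra.
- by rewrite d0.
- by rewrite ger0_norm; lra.
Qed.

Lemma bform_past q : circle q -> t <= fplus L q - sdist p q ->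
  0 <= bform v (pvec (q, fplus L q)).
Proof.
move=> cq le; have [M LM] := compact_norm Lc; have sq := circle_sphere cq.
have sp := disk_sphere dp; have [r Lr] := L0; have sr := circle_sphere (LE Lr).
have h1 := fplus_le LE LM sq Lr; have h2 := le_fminus LE LM sp Lr.
have h3 := sdist_perimeter sp sq sr.
have d0 := sdist_ge0 sp sq; have dpi := sdist_lepi sp sq.
have [lt _] := andP pt.
rewrite bform_pvec ?(proj2 cq)//= -cos_sdist// subr_ge0 leNgt cos_lt_norm.
- by rewrite -leNgt ler0_norm; lra.
- by rewrite d0.
- by rewrite ler0_norm; lra.
Qed.

Let vN01 : bform v (nvec A0 B1) < 0.
Proof.
have [_ Lal _ _ _] := gapI; rewrite /nvec (proj1 npt_corners); exact: pv.
Qed.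

Let vN10 : bform v (nvec A1 B0) < 0.
Proof.
have [_ _ Lbe _ _] := gapI; rewrite /nvec (proj2 npt_corners); exact: pv.
Qed.

Hypotheses (A01 : A0 < A1) (B01 : B0 < B1).

Let SA : 0 < sin (A1 - A0).
Proof.
have h := A01; have [w _] := gap_width_ltpi.
by rewrite sin_gt0_pi//; lra.
Qed.

Let SB : 0 < sin (B1 - B0).
Proof.
have h := B01; have [_ w] := gap_width_ltpi.
by rewrite sin_gt0_pi//; lra.
Qed.

Let combination (A B : R) : sin (A1 - A0) * sin (B1 - B0) * bform v (nvec A B) =
  sin (A1 - A) * sin (B - B0) * bform v (nvec A0 B1)
  + sin (A - A0) * sin (B1 - B) * bform v (nvec A1 B0)
  + sin (A - A0) * sin (B - B0) * bform v (nvec A1 B1)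
  + sin (A1 - A) * sin (B1 - B) * bform v (nvec A0 B0).
Proof.
rewrite (bformC v) -bformZl nvec_combination !bformDl !bformZl.
by rewrite !(bformC _ v).
Qed.

(* A point of the lower boundary of the diamond is a nonnegative combination of
   the lower corner and of one endpoint, on which [bform v] is negative. *)
Lemma bform_lower_corner phi : al < phi < be ->
  fminus L (cpt phi) + sdist p (cpt phi) <= t -> 0 <= bform v (nvec A0 B0).
Proof.
move=> phiab /(bform_future (circle_cpt phi)); rewrite fminus_gap//.
have [wA wB] := gap_width_ltpi; have [hA hB] := (A01, B01).
have [sA sB] := (SA, SB); have [h01 h10] := (vN01, vN10).
have SAB : 0 < sin (A1 - A0) * sin (B1 - B0) by rewrite mulr_gt0.
(* The larger term tells which lower side of the diamond carries the point over [phi]: [B = B0] or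
   [A = A0]. *)
have [le|lt] := leP (a - (phi - al)) (b - (be - phi)).
- have -> : (cpt phi, b - (be - phi)) = npt (B0 + phi) B0.
    by rewrite /npt /B0; congr (cpt _, _); field.
  rewrite -/(nvec _ _) -(pmulr_rge0 _ SAB) combination subrr sin0 !mulr0 !mul0r.
  rewrite add0r addr0 => h.
  have s1 : 0 <= sin (B0 + phi - A0).
    by rewrite sin_ge0_pi// /A0 /B0; rewrite /A0 /A1 in wA hA; lra.
  have s2 : 0 < sin (A1 - (B0 + phi)).
    by rewrite sin_gt0_pi// /A1 /B0; rewrite /A0 /A1 in wA hA; lra.
  rewrite -(pmulr_rge0 _ (mulr_gt0 s2 sB)); apply: le_trans h _.
  by rewrite gerDr (mulr_ge0_le0 (mulr_ge0 s1 (ltW sB)) (ltW h10)).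
- have -> : (cpt phi, a - (phi - al)) = npt A0 (A0 - phi).
    by rewrite /npt /A0; congr (cpt _, _); field.
  rewrite -/(nvec _ _) -(pmulr_rge0 _ SAB) combination subrr sin0 !mul0r.
  rewrite !addr0 => h.
  have s1 : 0 <= sin (A0 - phi - B0).
    by rewrite sin_ge0_pi// /A0 /B0; rewrite /B0 /B1 in wB hB; lra.
  have s2 : 0 < sin (B1 - (A0 - phi)).
    by rewrite sin_gt0_pi// /B1 /A0; rewrite /B0 /B1 in wB hB; lra.
  rewrite -(pmulr_rge0 _ (mulr_gt0 sA s2)); apply: le_trans h _.
  by rewrite gerDr (mulr_ge0_le0 (mulr_ge0 (ltW sA) s1) (ltW h01)).
Qed.

Lemma bform_upper_corner phi : al < phi < be ->
  t <= fplus L (cpt phi) - sdist p (cpt phi) -> 0 <= bform v (nvec A1 B1).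
Proof.
move=> phiab /(bform_past (circle_cpt phi)); rewrite fplus_gap//.
have [wA wB] := gap_width_ltpi; have [hA hB] := (A01, B01).
have [sA sB] := (SA, SB); have [h01 h10] := (vN01, vN10).
have SAB : 0 < sin (A1 - A0) * sin (B1 - B0) by rewrite mulr_gt0.
have [le|lt] := leP (a + (phi - al)) (b + (be - phi)).
- have -> : (cpt phi, a + (phi - al)) = npt (B1 + phi) B1.
    by rewrite /npt /B1; congr (cpt _, _); field.
  rewrite -/(nvec _ _) -(pmulr_rge0 _ SAB) combination subrr sin0 !mulr0 !mul0r.
  rewrite !addr0 => h.
  have s1 : 0 <= sin (A1 - (B1 + phi)).
    by rewrite sin_ge0_pi// /A1 /B1; rewrite /A0 /A1 in wA hA; lra.
  have s2 : 0 < sin (B1 + phi - A0).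
    by rewrite sin_gt0_pi// /A0 /B1; rewrite /A0 /A1 in wA hA; lra.
  rewrite -(pmulr_rge0 _ (mulr_gt0 s2 sB)); apply: le_trans h _.
  by rewrite gerDr (mulr_ge0_le0 (mulr_ge0 s1 (ltW sB)) (ltW h01)).
- have -> : (cpt phi, b + (be - phi)) = npt A1 (A1 - phi).
    by rewrite /npt /A1; congr (cpt _, _); field.
  rewrite -/(nvec _ _) -(pmulr_rge0 _ SAB) combination subrr sin0 !mul0r.
  rewrite add0r addr0 => h.
  have s1 : 0 <= sin (B1 - (A1 - phi)).
    by rewrite sin_ge0_pi// /A1 /B1; rewrite /B0 /B1 in wB hB; lra.
  have s2 : 0 < sin (A1 - phi - B0).
    by rewrite sin_gt0_pi// /B0 /A1; rewrite /B0 /B1 in wB hB; lra.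
  rewrite -(pmulr_rge0 _ (mulr_gt0 sA s2)); apply: le_trans h _.
  by rewrite gerDr (mulr_ge0_le0 (mulr_ge0 (ltW sA) s1) (ltW h10)).
Qed.

End point.

Lemma gap_closed_end p t phi phi' : disk p -> fminus L p < t < fplus L p ->
  al < phi < be -> al < phi' < be ->
  fminus L (cpt phi) + sdist p (cpt phi) <= t ->
  t <= fplus L (cpt phi') - sdist p (cpt phi') ->
  closed_end L I (ray_proj (p, t)).
Proof.
move=> dp pt phiab phiab' le le'.
have [M LM] := compact_norm Lc; have sp := disk_sphere dp.
have sphi := circle_sphere (circle_cpt phi).
have [A01 B01] : A0 < A1 /\ B0 < B1.
  have [_ Lal _ _ _] := gapI; have L0 : L !=set0 by exists (cpt al, a).
  (* Positive height over [phi] follows from [t < fplus L p] and the Lipschitz bound for [fplus],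
     and it gives both widths. *)
  have : fminus L (cpt phi) < fplus L (cpt phi).
    have := fplus_lip L0 LE LM sp sphi; lra.
  rewrite fminus_gap// fplus_gap// gt_max !lt_min => h.
  by rewrite /A0 /A1 /B0 /B1; lra.
have [wA wB] := gap_width_ltpi.
have vQ : qform (pvec (p, t)) < 0.
  rewrite /qform !mxE /=; have := cos2Dsin2 t; have [+ p2] := dp.
  by rewrite sphereE; have := exprn_gt0 2 p2; lra.
split; first by exists (pvec (p, t)).
have [_ Lal Lbe _ _] := gapI.
apply: (tetrahedron_sub_closure A01 B01).
- by rewrite sin_gt0_pi//; lra.
- by rewrite sin_gt0_pi//; lra.
- exact: pvec_neq0.
- exact: diamond_npt.
- rewrite /nvec (proj2 npt_corners) ltW//.
  exact: bform_invisible pt _.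
- rewrite /nvec (proj1 npt_corners) ltW//.
  exact: bform_invisible pt _.
- exact: bform_lower_corner le.
- exact: bform_upper_corner le'.
Qed.

(* Points of [L] separate the two gaps on both sides, so the inequality
   [fplus q' - fminus q <= sdist q q'] holds; equality can only occur for
   antipodal [q] and [q'], and then [L] lies in the past lightcone over [q']. *)
Lemma gap_not_crossed p t phi q : disk p -> al < phi < be -> circle q ->
  ~ (cpt @` `]al, be[%classic) q ->
  fminus L (cpt phi) + sdist p (cpt phi) <= t ->
  t <= fplus L q - sdist p q -> False.
Proof.
move=> dp phiab cq nIq le le'; have [M LM] := compact_norm Lc.
have [/andP[ab ba] Lal Lbe Lpar _] := gapI.
have [phi' phi'ab e] : exists2 phi' : R, be <= phi' <= al + pi *+ 2 & q = cpt phi'.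
  have [psi psim e] := circle_param al cq.
  have [alpsi|ne] := eqVneq al psi.
    by exists (al + pi *+ 2); [lra|rewrite cptD2pi alpsi].
  exists psi => //; have [lt|le1] := ltP psi be; last by lra.
  by case: nIq; exists psi => //=; rewrite in_itv /=; lra.
subst q; have sp := disk_sphere dp.
have sphi := circle_sphere (circle_cpt phi).
have sphi' := circle_sphere (circle_cpt phi').
have h1 : fplus L (cpt phi') <= b + (phi' - be).
  apply: le_trans (fplus_le LE LM sphi' Lbe) _ => /=.
  by have := sdist_cpt_le phi' be; rewrite ger0_norm; lra.
have h2 : fplus L (cpt phi') <= a + (al + pi *+ 2 - phi').
  apply: le_trans (fplus_le LE LM sphi' Lal) _ => /=.
  rewrite sdistC; have le1 : al <= phi' by lra.
  have le2 : phi' <= al + pi *+ 2 by lra.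
  by have := sdist_cpt_le2pi le1 le2; lra.
have h3 : b - (be - phi) <= fminus L (cpt phi).
  by rewrite fminus_gap// le_max lexx orbT.
have h4 : a - (phi - al) <= fminus L (cpt phi).
  by rewrite fminus_gap// le_max lexx.
have le1 : phi <= phi' by lra.
have le2 : phi' <= phi + pi *+ 2 by lra.
have := sdist_triangle sphi sp sphi'; rewrite (sdistC (cpt phi) p) => tri.
have dmin : sdist (cpt phi) (cpt phi') <= phi' - phi /\
    sdist (cpt phi) (cpt phi') <= pi *+ 2 - (phi' - phi).
  by rewrite sdist_cpt_min// !ge_min !lexx orbT.
(* [h1] to [h4] bound the height gain by both arcs between [phi] and [phi'], hence by their
   distance; by [le] and [le'] it is at least the length of the path through [p]. *)
have dpi : sdist (cpt phi) (cpt phi') = pi.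
  apply: (sdist_through_disk dp (circle_cpt phi) (circle_cpt phi')).
  by rewrite sdist_cpt_min// le_min; lra.
have [+ _] := @Lne (cpt phi', fplus L (cpt phi')) (circle_cpt _); apply => r Lr.
have [A [B [er hA hB]]] := gap_arc_npt Lr; subst r.
have := fplus_le LE LM sphi' Lr; rewrite /= => h5.
have := sdist_cpt_le phi' (A - B); rewrite distrC => h6.
rewrite /npt; suff -> : A + B = fplus L (cpt phi') - `|A - B - phi'|.
  exact: past_lightcone_cpt.
(* Since the gain equals [pi], [h1] and [h2] are equalities, so the upper bound on [A] or [B] meets
   the lower bound from [h5]. *)
rewrite /A0 /A1 /B0 /B1 in hA hB.
move: h6; case: (leP phi' (A - B)) => h.
- by rewrite ger0_norm; lra.
- by rewrite ltr0_norm; lra.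
Qed.

End GapAnalysis.

(* [L] is closed in the closed subspace [Einhat] iff it is closed in
   ['rV[R]_3 * R]. *)
Theorem proposition8p50 (R : realType) (L : set ('rV[R]_3 * R))
    (L_sub : L `<=` @Einhat R) (L_closed : closed L) (L_achronal : achronal L)
    (L_generic : generic L) (L_nonelementary : nonelementary L) :
  invisible_domain L =
    invisible_domain (graph_minus L) `|` invisible_domain (graph_plus L) `|`
    [set r | exists I x y, gap_pair L I x y /\ closed_end L I r].
Proof.
have Lc := compact_achronal L_sub L_closed L_achronal.
have [M LM] := compact_norm Lc.
have L0 : L !=set0.
  apply/set0P/eqP => L0; have [+ _] := L_nonelementary (cpt 0, 0) (circle_cpt 0).
  by apply; rewrite L0.
have gmE : graph_minus L `<=` @Einhat R by move=> q [].
have gpE : graph_plus L `<=` @Einhat R by move=> q [].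
have gmM := graph_minus_norm L0 L_sub LM; have gpM := graph_plus_norm L0 L_sub LM.
have Lgm := sub_graph_minus L0 L_sub LM L_achronal.
have Lgp := sub_graph_plus L0 L_sub LM L_achronal.
apply/seteqP; split=> [_ [[p t] [/= dp pt] <-]|r].
  have sp := disk_sphere dp; have [pt1 pt2] := andP pt.
  have [lt|] := ltP t (fplus (graph_minus L) p).
    left; left; exists (p, t) => //; split => //=; rewrite lt andbT.
    (* Passing to [graph_minus] does not raise the lower function, because [fminus L] is
       1-Lipschitz. *)
    apply: le_lt_trans pt1; apply: (fminus_le (graph_minus_neq0 L)) => q [cq ->].
    rewrite lerBlDr sdistC; exact: (fminus_lip L0 L_sub LM (circle_sphere cq) sp).
  have [q1 [cq1 ->] ->] := fplus_attained (graph_minus_neq0 L) gmE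
    (compact_graph_minus L0 L_sub LM) dp.
  have [lt|] := ltP (fminus (graph_plus L) p) t.
    move=> _; left; right; exists (p, t) => //; split => //=; rewrite lt /=.
    apply: lt_le_trans pt2 _; apply: (le_fplus (graph_plus_neq0 L)) => q [cq ->].
    exact: (fplus_lip L0 L_sub LM sp (circle_sphere cq)).
  have [q2 [cq2 ->] ->] := fminus_attained (graph_plus_neq0 L) gpE
    (compact_graph_plus L0 L_sub LM) dp.
  move: q1.1 q2.1 cq1 cq2 => x1 x2 cx1 cx2 le2 le1; right.
  have [phi _ e1] := circle_param 0 cx1; subst x1.
  (* Over a point of the base [fminus L] is the height of [L], so [le1] would give
     [fplus L p <= t]. *)
  have nB : ~ base_set L (cpt phi).
    case=> -[x s] Lxs /= ex; subst x.
    have := fplus_le L_sub LM sp Lxs.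
    have := fminus_achronal L0 L_sub LM L_achronal Lxs.
    by rewrite /= => e; rewrite e in le1; lra.
  have [al [be [a [b [phiab gapI]]]]] :=
    gap_arc_exists L_sub Lc L_achronal L_nonelementary nB.
  set I := connected_component _ _ in gapI.
  have [[phi' + e2]|nI] := pselect ((cpt @` `]al, be[%classic) x2); last first.
    by case: (gap_not_crossed L_sub Lc L_achronal gapI L_nonelementary dp
      phiab cx2 nI le1 le2).
  subst x2; rewrite /= in_itv /= => phiab'.
  exists I, (cpt al, a), (cpt be, b); split.
    apply: gap_arc_gap_pair gapI; exists (cpt phi); last by [].
    exact: (conj (circle_cpt phi) nB).
  exact: (gap_closed_end L_sub Lc L_achronal gapI L_nonelementary dp pt
    phiab phiab').
case=> [[|]|[I [x [y [[[p [cp nB] IE] _ _ _] end_r]]]]].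
(* Enlarging [L] to [graph_minus] can only raise the lower function and lower the upper one. *)
- move=> [[p t] [/= dp /andP[pt1 pt2]] <-]; exists (p, t) => //; split => //=.
  have sp := disk_sphere dp; apply/andP; split.
    apply: le_lt_trans pt1; apply: (fminus_le L0) => q Lq.
    by apply: (le_fminus gmE gmM sp); exact: Lgm.
  apply: lt_le_trans pt2 _; apply: (le_fplus L0) => q Lq.
  by apply: (fplus_le gmE gmM sp); exact: Lgm.
- move=> [[p t] [/= dp /andP[pt1 pt2]] <-]; exists (p, t) => //; split => //=.
  have sp := disk_sphere dp; apply/andP; split.
    apply: le_lt_trans pt1; apply: (fminus_le L0) => q Lq.
    by apply: (le_fminus gpE gpM sp); exact: Lgp.
  apply: lt_le_trans pt2 _; apply: (le_fplus L0) => q Lq.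
  by apply: (fplus_le gpE gpM sp); exact: Lgp.
- have [phi _ ep] := circle_param 0 cp; subst p.
  have [al [be [a [b [_ gapI]]]]] :=
    gap_arc_exists L_sub Lc L_achronal L_nonelementary nB.
  rewrite -IE in gapI.
  exact: (closed_end_invisible L_sub Lc L_achronal gapI L_nonelementary end_r).
Qed.
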